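(* Let $0<p<q\le 1$, $\tau\ge 0$, $0\le\eta<1$, $\kappa,\xi\in\mathbb{N}_0$, and suppose that $$\Big\{[\nu]_{p,q}^{\kappa}(\nu-\eta)\big\{1+([\nu]_{p,q}-1)\tau\big\}[1+(\nu-1)\tau]^{\xi}\Big\}_{\nu=2}^{\infty}$$ is a nondecreasing sequence. If $\varphi\in\mathcal{P}_{p,q}^{\xi,\kappa}(\tau,\eta)$, then for all $0<r<1$ and $\gamma>0$ $$\int_{0}^{2\pi}\left|\varphi(re^{i\theta})\right|^{\gamma}d\theta\le\int_{0}^{2\pi}\left|\varphi_{*}(re^{i\theta})\right|^{\gamma}d\theta,$$ where $$\varphi_{*}(z)=z-\frac{1-\eta}{[2]_{p,q}^{\kappa}(2-\eta)\big\{1+([2]_{p,q}-1)\tau\big\}(1+\tau)^{\xi}}\,z^{2}.$$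
   Context: $\Omega=\{z\in\mathbb{C}:|z|<1\}$; $\mathbb{N}_0=\mathbb{N}\cup\{0\}$. $\mathcal{A}$ is the class of analytic functions $\varphi$ on $\Omega$ with $\varphi(0)=0$, $\varphi'(0)=1$, so $\varphi(z)=z+\sum_{\nu\ge2}c_\nu z^\nu$. For $0<p<q\le1$, $[\nu]_{p,q}=\frac{p^\nu-q^\nu}{p-q}=\sum_{j=0}^{\nu-1}p^{\nu-1-j}q^{j}$. For $\varphi\in\mathcal{A}$, $\tau\ge0$, $\kappa,\xi\in\mathbb{N}_0$ define the operator $$\Upsilon_{\tau,p,q}^{\xi,\kappa}\varphi(z)=z+\sum_{\nu=2}^{\infty}[\nu]_{p,q}^{\kappa}[1+(\nu-1)\tau]^{\xi}c_\nu z^\nu .$$ For $0\le\eta<1$, $\tau\ge0$, $\mathcal{Q}_{p,q}^{\xi,\kappa}(\tau,\eta)$ is the class of $\varphi\in\mathcal{A}$ such that for all $z\in\Omega$ $$\operatorname{Re}\left\{\frac{(1-\tau)z\big(\Upsilon_{\tau,p,q}^{\xi,\kappa}\varphi(z)\big)'+\tau z\big(\Upsilon_{\tau,p,q}^{\xi,\kappa+1}\varphi(z)\big)'}{(1-\tau)\Upsilon_{\tau,p,q}^{\xi,\kappa}\varphi(z)+\tau\Upsilon_{\tau,p,q}^{\xi,\kappa+1}\varphi(z)}\right\}>\eta .$$ $\mathcal{T}$ is the subclass of $\mathcal{A}$ of functions of the form $\varphi(z)=z-\sum_{\nu=2}^{\infty}c_\nu z^\nu$ with all $c_\nu\ge0$,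 and $\mathcal{P}_{p,q}^{\xi,\kappa}(\tau,\eta)=\mathcal{Q}_{p,q}^{\xi,\kappa}(\tau,\eta)\cap\mathcal{T}$.
   Formalization: The formal theorem adds the hypothesis that the first term (ν=2) of the nondecreasing sequence is positive; without it the claim is false, e.g. p=1/10, q=1/5, τ=2, κ=5, ξ=0, η=0, γ=2. *)

(* Defs.v *)
From Stdlib Require Import Reals Factorial.
From Coquelicot Require Import Coquelicot.
Open Scope R_scope.

Definition Omega (z : C) : Prop := Cmod z < 1.

(** [x ^ g] for [x >= 0] and [g > 0]. [Rpower 0 g = 1], since [ln 0 = 0] in
    the standard library, so the value at [0] has to be set apart. *)
Definition rpow (x g : R) : R :=
  if Req_EM_T x 0 then 0 else Rpower x g.

(** Sum of a complex series, meaningful when the series converges. *)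
Definition CSeries (a : nat -> C) : C :=
  (Series (fun k => Re (a k)), Series (fun k => Im (a k))).

Fixpoint C_derive_n (f : C -> C) (n : nat) : C -> C :=
  match n with
  | O => f
  | S m => C_derive (C_derive_n f m)
  end.

(** The coefficient of [z ^ n] in the expansion of [f] at the origin. *)
Definition coef (f : C -> C) (n : nat) : C :=
  (C_derive_n f n 0 / INR (fact n))%C.

Definition classA (f : C -> C) : Prop :=
  (forall z : C, Omega z -> ex_derive (K := C_AbsRing) (V := C_NormedModule) f z)
  /\ f (RtoC 0) = RtoC 0
  /\ C_derive f (RtoC 0) = RtoC 1.

Definition pqnum (p q : R) (n : nat) : R := (p ^ n - q ^ n) / (p - q).

(** The sum over [n >= 2] is reindexed by [n = k + 2]. *)
Definition Upsilon (tau p q : R) (xi kappa : nat) (f : C -> C) (z : C) : C :=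
  (z + CSeries (fun k =>
         (pqnum p q (k + 2) ^ kappa * (1 + INR (k + 1) * tau) ^ xi)%R
         * coef f (k + 2) * z ^ (k + 2)))%C.

(** The condition is imposed at [z <> 0]: at the origin the quotient is to be
    read as its limit, which is [1] for every [f] in [classA], so that the
    condition holds there. A zero of the denominator elsewhere in the disc is
    excluded: there the quotient below is [0], which contradicts
    [0 <= eta < Re _]. *)
Definition classQ (p q : R) (xi kappa : nat) (tau eta : R) (f : C -> C) : Prop :=
  classA f /\
  forall z : C, Omega z -> z <> RtoC 0 ->
    eta <
    Re (((1 - tau)%R * z * C_derive (Upsilon tau p q xi kappa f) z
         + tau * z * C_derive (Upsilon tau p q xi (S kappa) f) z)
        / ((1 - tau)%R * Upsilon tau p q xi kappa f z
           + tau * Upsilon tau p q xi (S kappa) f z))%C.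

Definition classT (f : C -> C) : Prop :=
  classA f /\
  exists c : nat -> R,
    (forall n : nat, (2 <= n)%nat -> 0 <= c n) /\
    forall z : C, Omega z ->
      is_series (K := C_AbsRing) (V := C_NormedModule)
        (fun k => c (k + 2)%nat * z ^ (k + 2))%C (z - f z)%C.

Definition classP (p q : R) (xi kappa : nat) (tau eta : R) (f : C -> C) : Prop :=
  classQ p q xi kappa tau eta f /\ classT f.

Definition weight (p q : R) (xi kappa : nat) (tau eta : R) (n : nat) : R :=
  pqnum p q n ^ kappa * (INR n - eta) * (1 + (pqnum p q n - 1) * tau)
  * (1 + (INR n - 1) * tau) ^ xi.

Definition phi_star (p q : R) (xi kappa : nat) (tau eta : R) (z : C) : C :=
  (z - ((1 - eta) /
        (pqnum p q 2 ^ kappa * (2 - eta) * (1 + (pqnum p q 2 - 1) * tau)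
         * (1 + tau) ^ xi))%R * z ^ 2)%C.

(** [r e^(i theta)] *)
Definition circle (r theta : R) : C := (r * cos theta, r * sin theta).

(* Main.v *)
Require Import Defs.
From Stdlib Require Import Reals Lra Lia Factorial FunctionalExtensionality.
From Coquelicot Require Import Coquelicot.
Open Scope R_scope.

(** Restricted to the radius [(0, 1)] the defining inequality of the class says
    that [(1 - eta) x - sum weight_k c_k x^k > 0]; letting [x] tend to [1] and
    using monotonicity of the weights, [sum c_k <= a := (1 - eta) / weight_2].
    Hence [phi z = z (1 - a w z)] with [w] in the disc and [w 0 = 0], whereas
    [phi_star z = z (1 - a z)], and the claim is Littlewood's subordination
    inequality for the function [|1 - b z|^gamma], [b = a r].

    For [b < 1] write [|1 - b z|^gamma = |h z|^2] with [h z = (1 - b z)^(gamma/2)]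
    expanded by the binomial series. If [P = P 0 + z Q], then [P 0] is orthogonal
    to [w Q(w)] on the circle, so induction on the degree gives
    [int |P (w)|^2 <= int |P|^2] for polynomials, and uniform limits give it for
    [h]. The case [b = 1] is a limit, and for [b > 1] a Blaschke factor moves the
    zero [1/b] out of the disc. *)

(** All coefficients involved are real. This is why the first half can stay on the real axis, where
    [C_derive], [coef] and [Upsilon] turn into operations on real power series.

    The second half uses no Cauchy formula and no maximum principle: [w] enters only through its
    truncations, which on a circle are trigonometric polynomials with positive frequencies. For
    these, [w 0 = 0] becomes a vanishing mean, and the bound on [w] is the triangle inequality for
    nonnegative coefficients of sum at most [a].

    The parameter [b] can exceed 1, because the factor [1 + (p + q - 1) * tau] of the second weight
    may be close to 0. In that case [(1 - b z)^(gamma/2)] has a branch point inside the disc in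
    general, and its binomial series no longer converges on the circle. *)

(** * Real power series and [C_derive] on the real axis *)

(** [C_derive] is the limit of the difference quotients taken along the
    horizontal direction only, so it is blind to [f] off the real axis. *)
Lemma C_derive_real (f : C -> C) (g : R -> R) (x l : R) :
  locally x (fun t => f (RtoC t) = RtoC (g t)) ->
  is_derive g x l -> C_derive f (RtoC x) = RtoC l.
Proof.
  intros Hloc Hd.
  assert (Hx : f (RtoC x) = RtoC (g x)) by exact (locally_singleton _ _ Hloc).
  assert (Hq : Lim (fun y => (g y - g x) / (y - x)) x = l).
  { apply is_lim_unique.
    apply is_derive_Reals in Hd.
    apply is_lim_spec; intros eps.
    destruct (Hd eps (cond_pos eps)) as [del Hdel].
    exists del; refine (fun (y : R) Hy Hyx => _).
    assert (Hne : y - x <> 0) by lra.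
    specialize (Hdel (y - x) Hne Hy).
    replace (x + (y - x)) with y in Hdel by ring; exact Hdel. }
  assert (Hquot : locally' x (fun y =>
    ((f (RtoC y) - f (RtoC x)) / (RtoC y - RtoC x))%C
    = RtoC ((g y - g x) / (y - x)))).
  { destruct Hloc as [d Hd0]. exists d; intros y Hy Hyx.
    rewrite (Hd0 y Hy), Hx, <- !RtoC_minus, <- RtoC_div by lra; reflexivity. }
  unfold C_derive, C_lim; apply injective_projections.
  - change (real (Lim (fun y =>
      fst ((f (RtoC y) - f (RtoC x)) / (RtoC y - RtoC x))%C) x) = l).
    transitivity (real (Lim (fun y => (g y - g x) / (y - x)) x));
      [apply f_equal, Lim_ext_loc | now rewrite Hq].
    apply filter_imp with (2 := Hquot); intros y Hy; now rewrite Hy.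
  - change (real (Lim (fun y =>
      snd ((f (RtoC y) - f (RtoC x)) / (RtoC y - RtoC x))%C) x) = 0).
    transitivity (real (Lim (fun _ => 0) x));
      [apply f_equal, Lim_ext_loc | now rewrite Lim_const].
    apply filter_imp with (2 := Hquot); intros y Hy; now rewrite Hy.
Qed.

Definition unit_radius (a : nat -> R) : Prop := Rbar_le 1 (CV_radius a).

Lemma unit_radius_lt (a : nat -> R) (x : R) :
  unit_radius a -> Rabs x < 1 -> Rbar_lt (Rabs x) (CV_radius a).
Proof. intros Ha Hx; exact (Rbar_lt_le_trans (Rabs x) 1 _ Hx Ha). Qed.

Lemma unit_radius_bounded (a : nat -> R) :
  (forall x, 0 < x < 1 -> exists M, forall n, Rabs (a n * x ^ n) <= M) ->
  unit_radius a.
Proof.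
  intros H.
  destruct (CV_radius_bounded a) as [Hub _].
  unfold unit_radius.
  assert (Hx : forall x, 0 < x < 1 -> Rbar_le x (CV_radius a))
    by (intros x Hx; exact (Hub x (H x Hx))).
  destruct (CV_radius a) as [r | |]; simpl.
  - apply Rnot_lt_le; intros Hr.
    (* A point of [(0, 1)] beyond [r]; the maximum with [1 / 2] keeps it positive whatever the sign
       of [r]. *)
    assert (H1 : 0 < Rmax (1 / 2) ((1 + r) / 2) < 1).
    { split; [apply Rlt_le_trans with (2 := Rmax_l _ _); lra |].
      apply Rmax_lub_lt; lra. }
    specialize (Hx _ H1); simpl in Hx.
    generalize (Rmax_r (1 / 2) ((1 + r) / 2)); lra.
  - exact I.
  - apply (Hx (1 / 2)); lra.
Qed.

Lemma unit_radius_le (a b : nat -> R) (K : R) :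
  0 <= K -> unit_radius a -> (forall n, Rabs (b n) <= K * Rabs (a n)) -> unit_radius b.
Proof.
  intros HK Ha Hb. apply unit_radius_bounded; intros x Hx.
  assert (Hr : ex_series (fun n => Rabs (a n * x ^ n))).
  { apply CV_disk_inside, unit_radius_lt; [exact Ha | rewrite Rabs_pos_eq; lra]. }
  apply ex_series_lim_0 in Hr.
  destruct (filterlim_bounded (V := R_NormedModule) _ (ex_intro _ 0 Hr)) as [M HM].
  exists (K * M); intros n.
  specialize (HM n); change (Rabs (Rabs (a n * x ^ n)) <= M) in HM.
  rewrite Rabs_Rabsolu in HM.
  rewrite Rabs_mult in *.
  apply Rle_trans with (K * (Rabs (a n) * Rabs (x ^ n))).
  - rewrite <- Rmult_assoc. apply Rmult_le_compat_r; [apply Rabs_pos | apply Hb].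
  - now apply Rmult_le_compat_l.
Qed.

Lemma unit_radius_ext (a b : nat -> R) :
  (forall n, a n = b n) -> unit_radius a -> unit_radius b.
Proof. intros E Ha; unfold unit_radius; now rewrite <- (CV_radius_ext _ _ E). Qed.

Lemma unit_radius_INR (a : nat -> R) :
  unit_radius a -> unit_radius (fun n => INR n * a n).
Proof.
  intros Ha; unfold unit_radius.
  rewrite <- (CV_radius_ext (PS_incr_1 (PS_derive a))).
  - now rewrite CV_radius_incr_1, CV_radius_derive.
  - intros [| n]; [symmetry; apply Rmult_0_l | reflexivity].
Qed.

Lemma unit_radius_comb (s t : R) (a b : nat -> R) :
  unit_radius a -> unit_radius b -> unit_radius (fun n => s * a n + t * b n).
Proof.
  intros Ha Hb; unfold unit_radius.
  rewrite <- (CV_radius_ext (PS_plus (PS_scal s a) (PS_scal t b))) by reflexivity.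
  apply Rbar_le_trans with (2 := CV_radius_plus _ _).
  assert (H : forall r c, unit_radius c -> Rbar_le 1 (CV_radius (PS_scal r c))).
  { intros r c Hc. apply (unit_radius_le c _ (Rabs r)); [apply Rabs_pos | exact Hc |].
    intros n; rewrite <- Rabs_mult; apply Rle_refl. }
  apply Rbar_min_case; now apply H.
Qed.

Lemma PSeries_comb (s t : R) (a b : nat -> R) (x : R) :
  unit_radius a -> unit_radius b -> Rabs x < 1 ->
  PSeries (fun n => s * a n + t * b n) x = s * PSeries a x + t * PSeries b x.
Proof.
  intros Ha Hb Hx.
  rewrite <- !PSeries_scal, <- PSeries_plus; [reflexivity | |];
    apply ex_pseries_scal; try apply Rmult_comm;
    now apply CV_radius_inside, unit_radius_lt.
Qed.

Lemma PSeries_INR (a : nat -> R) (x : R) :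
  PSeries (fun n => INR n * a n) x = x * PSeries (PS_derive a) x.
Proof.
  rewrite <- PSeries_incr_1. apply PSeries_ext.
  intros [| n]; [apply Rmult_0_l | reflexivity].
Qed.

Lemma locally_unit (x : R) : Rabs x < 1 -> locally x (fun y => Rabs y < 1).
Proof.
  intros Hx. assert (He : 0 < 1 - Rabs x) by lra.
  exists (mkposreal _ He); refine (fun (y : R) Hy => _).
  change (Rabs (y - x) < 1 - Rabs x) in Hy.
  replace y with (x + (y - x)) by ring.
  generalize (Rabs_triang x (y - x)); lra.
Qed.

Lemma C_derive_n_real (f : C -> C) (a : nat -> R) (n : nat) (x : R) :
  unit_radius a ->
  (forall t, Rabs t < 1 -> f (RtoC t) = RtoC (PSeries a t)) ->
  Rabs x < 1 ->
  C_derive_n f n (RtoC x) = RtoC (PSeries (PS_derive_n n a) x).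
Proof.
  intros Ha Hf; revert x; induction n as [| n IH]; intros x Hx; simpl.
  - rewrite Hf by exact Hx; f_equal; apply PSeries_ext; intros n.
    unfold PS_derive_n; rewrite Nat.add_0_r; field; apply INR_fact_neq_0.
  - apply C_derive_real with (g := Derive_n (PSeries a) n).
    + apply filter_imp with (2 := locally_unit x Hx); intros t Ht.
      rewrite Derive_n_PSeries by now apply unit_radius_lt. now apply IH.
    + exact (is_derive_n_PSeries (S n) a x (unit_radius_lt a x Ha Hx)).
Qed.

(** Makes [Upsilon] computable: it reads the coefficients of [f] off iterated [C_derive] at the
    origin, and these see only the values of [f] on the real axis. *)
Lemma coef_real (f : C -> C) (a : nat -> R) (n : nat) :
  unit_radius a ->
  (forall t, Rabs t < 1 -> f (RtoC t) = RtoC (PSeries a t)) ->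
  coef f n = RtoC (a n).
Proof.
  intros Ha Hf. unfold coef.
  assert (H0 : Rabs 0 < 1) by (rewrite Rabs_R0; lra).
  rewrite (C_derive_n_real f a n 0 Ha Hf H0).
  assert (Hr := unit_radius_lt a 0 Ha H0).
  rewrite <- Derive_n_PSeries by exact Hr; rewrite Rabs_R0 in Hr.
  rewrite Derive_n_coef by exact Hr.
  rewrite <- RtoC_div by apply INR_fact_neq_0.
  f_equal; field; apply INR_fact_neq_0.
Qed.

(** * The coefficient inequality *)

Lemma is_series_Re_Im (u : nat -> C) (l : C) :
  is_series (K := C_AbsRing) (V := C_NormedModule) u l ->
  is_series (fun k => Re (u k)) (Re l) /\ is_series (fun k => Im (u k)) (Im l).
Proof.
  intros H.
  assert (E : forall n, sum_n (G := C_AbelianMonoid) u n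
            = (sum_n (fun k => Re (u k)) n, sum_n (fun k => Im (u k)) n)).
  { intros n; induction n as [| n IH]; [now rewrite !sum_O, <- surjective_pairing |].
    now rewrite !sum_Sn, IH. }
  unfold is_series in *.
  split.
  - apply filterlim_ext with (fun n => fst (sum_n (G := C_AbelianMonoid) u n));
      [intros n; now rewrite E |].
    apply (filterlim_comp _ _ _ _ fst _ _ _ H).
    exact (continuous_fst (U := R_UniformSpace) (V := R_UniformSpace) (fst l) (snd l)).
  - apply filterlim_ext with (fun n => snd (sum_n (G := C_AbelianMonoid) u n));
      [intros n; now rewrite E |].
    apply (filterlim_comp _ _ _ _ snd _ _ _ H).
    exact (continuous_snd (U := R_UniformSpace) (V := R_UniformSpace) (fst l) (snd l)).
Qed.

(** In [classT] the values [c 0] and [c 1] are arbitrary, so the first two coefficients are set by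
    hand. *)
Definition T_coef (c : nat -> R) (n : nat) : R :=
  match n with O => 0 | S O => 1 | S (S _) => - c n end.

Lemma PSeries_shift2 (a : nat -> R) (x : R) :
  a 0%nat = 0 -> a 1%nat = 1 ->
  ex_series (fun k => a (k + 2)%nat * x ^ (k + 2)) ->
  PSeries a x = x + Series (fun k => a (k + 2)%nat * x ^ (k + 2)).
Proof.
  intros H0 H1 Hex. unfold PSeries.
  rewrite (Series_incr_n (fun k => a k * x ^ k) 2); [| lia |].
  - simpl; rewrite H0, H1. rewrite (Series_ext (fun k => a (S (S k)) * (x * (x * x ^ k)))
      (fun k => a (k + 2)%nat * x ^ (k + 2))); [ring |].
    intros k; rewrite (Nat.add_comm k 2); reflexivity.
  - apply (ex_series_incr_n _ 2).
    apply ex_series_ext with (2 := Hex); intros k; now rewrite (Nat.add_comm k 2).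
Qed.

Lemma T_coef_series (f : C -> C) (c : nat -> R) :
  (forall z : C, Omega z ->
      is_series (K := C_AbsRing) (V := C_NormedModule)
        (fun k => c (k + 2)%nat * z ^ (k + 2))%C (z - f z)%C) ->
  unit_radius (T_coef c) /\
  forall t, Rabs t < 1 -> f (RtoC t) = RtoC (PSeries (T_coef c) t).
Proof.
  intros H.
  assert (Hs : forall t, Rabs t < 1 ->
    is_series (fun k => c (k + 2)%nat * t ^ (k + 2)) (t - Re (f (RtoC t)))
    /\ Im (f (RtoC t)) = 0).
  { intros t Ht.
    assert (HO : Omega (RtoC t)) by (unfold Omega; now rewrite Cmod_R).
    destruct (is_series_Re_Im _ _ (H _ HO)) as [Hre Him].
    assert (E : forall k, (c (k + 2)%nat * RtoC t ^ (k + 2))%C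
                = RtoC (c (k + 2)%nat * t ^ (k + 2)))
      by (intros k; now rewrite RtoC_mult, RtoC_pow).
    split.
    - apply is_series_ext with (2 := Hre); intros k; now rewrite E.
    - apply is_series_unique in Him.
      (* The terms vanish; in the shape [0 * 0] their sum is 0 by [Series_scal_l], with no
         convergence to prove. *)
      rewrite (Series_ext _ (fun _ => 0 * 0)) in Him
        by (intros k; rewrite E; simpl; ring).
      rewrite Series_scal_l in Him.
      change (0 * Series (fun _ => 0) = 0 + - Im (f (RtoC t))) in Him; lra. }
  assert (Hneg : forall t, Rabs t < 1 ->
    is_series (fun k => T_coef c (k + 2)%nat * t ^ (k + 2)) (Re (f (RtoC t)) - t)).
  { intros t Ht. destruct (Hs t Ht) as [Hre _].
    replace (Re (f (RtoC t)) - t) with (scal (-1) (t - Re (f (RtoC t))))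
      by (unfold scal; simpl; unfold mult; simpl; ring).
    apply is_series_ext with (2 := is_series_scal_l _ _ _ Hre).
    intros k; rewrite (Nat.add_comm k 2); unfold scal; simpl; unfold mult; simpl; ring. }
  split.
  - apply unit_radius_bounded; intros x Hx.
    assert (Hx1 : Rabs x < 1) by (rewrite Rabs_pos_eq; lra).
    assert (Hex : ex_series (fun k => T_coef c k * x ^ k)).
    { apply (ex_series_incr_n _ 2).
      apply ex_series_ext with (2 := ex_intro _ _ (Hneg x Hx1)).
      intros k; now rewrite (Nat.add_comm k 2). }
    apply ex_series_lim_0 in Hex.
    destruct (filterlim_bounded (V := R_NormedModule) _ (ex_intro _ 0 Hex)) as [M HM].
    exists M; exact HM.
  - intros t Ht. destruct (Hs t Ht) as [_ Him].
    rewrite PSeries_shift2; [| reflexivity | reflexivity | eexists; exact (Hneg t Ht)].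
    rewrite (is_series_unique _ _ (Hneg t Ht)).
    apply injective_projections; simpl; [unfold Re; ring | exact Him].
Qed.

(** * The (p,q)-numbers and [Upsilon] on the real axis *)

Lemma pqnum_1 (p q : R) : p < q -> pqnum p q 1 = 1.
Proof. intros hpq; unfold pqnum; field; lra. Qed.

Lemma pqnum_ge_0 (p q : R) (n : nat) : 0 < p -> p < q -> 0 <= pqnum p q n.
Proof.
  intros hp hpq.
  unfold pqnum.
  replace ((p ^ n - q ^ n) / (p - q)) with ((q ^ n - p ^ n) * / (q - p)) by (field; lra).
  apply Rmult_le_pos; [| left; apply Rinv_0_lt_compat; lra].
  assert (p ^ n <= q ^ n) by (apply pow_incr; lra); lra.
Qed.

Lemma pqnum_le (p q : R) (n : nat) :
  0 < p -> p < q -> q <= 1 -> pqnum p q n <= / (q - p).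
Proof.
  intros hp hpq hq.
  unfold pqnum.
  replace ((p ^ n - q ^ n) / (p - q)) with ((q ^ n - p ^ n) * / (q - p)) by (field; lra).
  rewrite <- (Rmult_1_l (/ (q - p))) at 2.
  apply Rmult_le_compat_r; [left; apply Rinv_0_lt_compat; lra |].
  assert (0 <= p ^ n) by (apply pow_le; lra).
  assert (q ^ n <= 1 ^ n) by (apply pow_incr; lra).
  rewrite pow1 in *; lra.
Qed.

Definition Upsilon_coef (tau p q : R) (xi kappa : nat) (a : nat -> R) (n : nat) : R :=
  pqnum p q n ^ kappa * (1 + (INR n - 1) * tau) ^ xi * a n.

(** One factor [1 + (n - 1) tau] turns [a] into [(1 - tau) a + tau (n a)], a combination of the
    series and of [x] times its derivative. The factors [pqnum p q n] are bounded by [1 / (q - p)],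
    so neither kind of factor shrinks the disc of convergence below the unit disc. *)
Lemma unit_radius_Upsilon (tau p q : R) (xi kappa : nat) (a : nat -> R) :
  0 < p -> p < q -> q <= 1 ->
  unit_radius a -> unit_radius (Upsilon_coef tau p q xi kappa a).
Proof.
  intros hp hpq hq Ha.
  assert (H1 : unit_radius (fun n => (1 + (INR n - 1) * tau) ^ xi * a n)).
  { induction xi as [| m IH].
    - apply unit_radius_ext with (2 := Ha); intros n; simpl; ring.
    - apply unit_radius_ext with
        (2 := unit_radius_comb (1 - tau) tau _ _ IH (unit_radius_INR _ IH)).
      intros n; simpl; ring. }
  induction kappa as [| m IH].
  - apply unit_radius_ext with (2 := H1); intros n; unfold Upsilon_coef; simpl; ring.
  - apply unit_radius_le with (2 := IH) (K := / (q - p)).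
    + left; apply Rinv_0_lt_compat; lra.
    + intros n. unfold Upsilon_coef; simpl.
      rewrite !Rmult_assoc, (Rabs_mult (pqnum p q n)).
      apply Rmult_le_compat_r; [apply Rabs_pos |].
      rewrite Rabs_pos_eq; [now apply pqnum_le | now apply pqnum_ge_0].
Qed.

Lemma CSeries_RtoC (u : nat -> C) (v : nat -> R) :
  (forall k, u k = RtoC (v k)) -> CSeries u = RtoC (Series v).
Proof.
  intros E. unfold CSeries. apply injective_projections; simpl.
  - apply Series_ext; intros k; now rewrite E.
  - rewrite (Series_ext _ (fun _ => 0 * 0)) by (intros k; rewrite E; simpl; ring).
    rewrite Series_scal_l; ring.
Qed.

Lemma Upsilon_real (tau p q : R) (xi kappa : nat) (f : C -> C) (a : nat -> R) (x : R) :
  0 < p -> p < q -> q <= 1 ->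
  unit_radius a -> a 0%nat = 0 -> a 1%nat = 1 ->
  (forall t, Rabs t < 1 -> f (RtoC t) = RtoC (PSeries a t)) ->
  Rabs x < 1 ->
  Upsilon tau p q xi kappa f (RtoC x) = RtoC (PSeries (Upsilon_coef tau p q xi kappa a) x).
Proof.
  intros hp hpq hq Ha H0 H1 Hf Hx.
  assert (HU := unit_radius_Upsilon tau p q xi kappa a hp hpq hq Ha).
  rewrite PSeries_shift2.
  - unfold Upsilon. rewrite RtoC_plus. f_equal.
    assert (E : forall k, (RtoC (pqnum p q (k + 2) ^ kappa * (1 + INR (k + 1) * tau) ^ xi)
                           * coef f (k + 2) * RtoC x ^ (k + 2))%C
       = RtoC (Upsilon_coef tau p q xi kappa a (k + 2) * x ^ (k + 2))).
    { intros k. rewrite (coef_real f a _ Ha Hf). unfold Upsilon_coef.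
      replace (INR (k + 2) - 1) with (INR (k + 1))
        by (rewrite !plus_INR; simpl; ring).
      now rewrite <- RtoC_pow, <- !RtoC_mult. }
    now apply CSeries_RtoC.
  - unfold Upsilon_coef; rewrite H0; ring.
  - unfold Upsilon_coef; rewrite H1, pqnum_1 by exact hpq; simpl.
    replace (1 + (1 - 1) * tau) with 1 by ring; rewrite !pow1; ring.
  - assert (Hex := CV_radius_inside _ _ (unit_radius_lt _ _ HU Hx)).
    apply ex_pseries_R in Hex. apply (ex_series_incr_n _ 2) in Hex.
    apply ex_series_ext with (2 := Hex); intros k; now rewrite (Nat.add_comm k 2).
Qed.

(** Carries out [x -> 1] for a partial sum up to [N]: each [x^(k+2)] is bounded below by the
    smallest power [x^(N+2)], so only one power remains in the limit. *)
Lemma pow_mult_le_limit (N : nat) (s t : R) :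
  (forall x, 0 < x < 1 -> x ^ N * s <= t) -> s <= t.
Proof.
  intros H. apply Rnot_lt_le; intros Hlt.
  assert (Hc : continuity_pt (fun x => x ^ N * s) 1) by reg.
  destruct (Hc (s - t) (Rgt_minus _ _ Hlt)) as [d [Hd Hd']].
  set (e := Rmin (d / 2) (1 / 2)).
  assert (He : 0 < e) by (apply Rmin_pos; lra).
  assert (He1 : e <= d / 2) by apply Rmin_l.
  assert (He2 : e <= 1 / 2) by apply Rmin_r.
  specialize (H (1 - e)).
  specialize (Hd' (1 - e)). simpl in Hd'; unfold R_dist in Hd'.
  rewrite pow1, Rmult_1_l in Hd'.
  assert (Rabs ((1 - e) ^ N * s - s) < s - t).
  { apply Hd'; split; [split; [exact I | lra] |].
    replace (1 - e - 1) with (- e) by ring; rewrite Rabs_Ropp, Rabs_pos_eq; lra. }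
  apply Rabs_def2 in H0. lra.
Qed.

(** For [B = 0] both sides are 0 by the conventions on division, so the class condition can be made
    real before its denominator is known not to vanish. *)
Lemma Re_RtoC_div (A B : R) : Re (RtoC A / RtoC B)%C = A / B.
Proof.
  destruct (Req_EM_T B 0) as [-> | HB].
  - simpl; unfold Rdiv; rewrite Rinv_0; ring.
  - now rewrite <- RtoC_div.
Qed.

(** Dividing the series by [y] leaves a continuous function equal to 1 at the origin; by the
    intermediate value theorem it cannot become nonpositive without a zero in [(0, x]]. *)
Lemma PSeries_pos_of_nonzero (v : nat -> R) (x : R) :
  unit_radius v -> v 0%nat = 0 -> v 1%nat = 1 ->
  (forall y, 0 < y < 1 -> PSeries v y <> 0) ->
  0 < x < 1 -> 0 < PSeries v x.
Proof.
  intros Hv H0 H1 Hnz Hx.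
  set (g := PSeries (PS_decr_1 v)).
  assert (Hr : unit_radius (PS_decr_1 v)) by (unfold unit_radius; now rewrite CV_radius_decr_1).
  assert (Hg : forall y, Rabs y < 1 -> PSeries v y = y * g y).
  { intros y Hy. rewrite PSeries_decr_1, H0; [unfold g; ring |].
    now apply CV_radius_inside, unit_radius_lt. }
  assert (Hg0 : g 0 = 1) by (unfold g; rewrite PSeries_0; exact H1).
  assert (Hgx : 0 < g x).
  { apply Rnot_le_lt; intros Hle.
    destruct (Rle_lt_or_eq_dec _ _ Hle) as [Hlt | Heq].
    - destruct (Ranalysis5.IVT_interv (fun y => - g y) 0 x) as [y [Hy Hgy]]; try lra.
      + intros a Ha. apply continuity_pt_opp, PSeries_continuity, unit_radius_lt; [exact Hr |].
        rewrite Rabs_pos_eq; lra.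
      + assert (y <> 0) by (intros ->; lra).
        apply (Hnz y); [lra |].
        rewrite Hg by (rewrite Rabs_pos_eq; lra).
        replace (g y) with 0 by lra; ring.
    - apply (Hnz x Hx). rewrite Hg by (rewrite Rabs_pos_eq; lra). rewrite Heq; ring. }
  rewrite Hg by (rewrite Rabs_pos_eq; lra).
  apply Rmult_lt_0_compat; lra.
Qed.

Lemma nondecreasing_from (u : nat -> R) (m n : nat) :
  (forall k : nat, (m <= k)%nat -> u k <= u (S k)) -> (m <= n)%nat -> u m <= u n.
Proof.
  intros H Hn; induction Hn as [| k Hk IH]; [apply Rle_refl |].
  apply Rle_trans with (1 := IH), H, Hk.
Qed.

(** With [v] the coefficients of the denominator, the numerator is [y] times the derivative of that
    series. Once the denominator is positive, the condition can be multiplied out to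
    [y v' - eta v > 0], and the coefficients [(n - eta) v_n] of the left side are exactly
    [weight n * a n]. *)
Lemma classQ_real (p q tau eta : R) (xi kappa : nat) (f : C -> C) (a : nat -> R) (x : R) :
  0 < p -> p < q -> q <= 1 -> 0 <= eta ->
  classQ p q xi kappa tau eta f ->
  unit_radius a -> a 0%nat = 0 -> a 1%nat = 1 ->
  (forall t, Rabs t < 1 -> f (RtoC t) = RtoC (PSeries a t)) ->
  0 < x < 1 ->
  unit_radius (fun n => weight p q xi kappa tau eta n * a n) /\
  0 < PSeries (fun n => weight p q xi kappa tau eta n * a n) x.
Proof.
  intros hp hpq hq heta [_ HQ] Ha H0 H1 Hf Hx.
  set (u := fun k => Upsilon_coef tau p q xi k a).
  assert (Hu : forall k, unit_radius (u k)) by (intros k; now apply unit_radius_Upsilon).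
  set (v := fun n => (1 - tau) * u kappa n + tau * u (S kappa) n).
  assert (Hv : unit_radius v) by now apply unit_radius_comb.
  assert (Hw : forall n, 1 * (INR n * v n) + - eta * v n
                         = weight p q xi kappa tau eta n * a n).
  { intros n; unfold v, u, Upsilon_coef, weight; simpl; ring. }
  split.
  { apply unit_radius_ext with (1 := Hw), unit_radius_comb; [apply unit_radius_INR |]; exact Hv. }
  assert (Hv0 : v 0%nat = 0) by (unfold v, u, Upsilon_coef; rewrite H0; ring).
  assert (Hv1 : v 1%nat = 1).
  { unfold v, u, Upsilon_coef; rewrite H1, pqnum_1 by exact hpq; simpl.
    replace (1 + (1 - 1) * tau) with 1 by ring; rewrite !pow1; ring. }
  assert (Hquot : forall y, 0 < y < 1 ->
    eta < y * PSeries (PS_derive v) y / PSeries v y).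
  { intros y Hy.
    assert (Hy1 : Rabs y < 1) by (rewrite Rabs_pos_eq; lra).
    assert (HU : forall k t, Rabs t < 1 ->
      Upsilon tau p q xi k f (RtoC t) = RtoC (PSeries (u k) t))
      by (intros k t Ht; now apply Upsilon_real).
    assert (HD : forall k, C_derive (Upsilon tau p q xi k f) (RtoC y)
                           = RtoC (PSeries (PS_derive (u k)) y)).
    { intros k. apply C_derive_real with (g := PSeries (u k)).
      - apply filter_imp with (2 := locally_unit y Hy1); intros t; apply HU.
      - now apply is_derive_PSeries, unit_radius_lt. }
    assert (Hy0 : RtoC y <> RtoC 0) by (intros E; apply RtoC_inj in E; lra).
    assert (HO : Omega (RtoC y)) by (unfold Omega; now rewrite Cmod_R).
    specialize (HQ _ HO Hy0).
    rewrite !HD, !HU in HQ by exact Hy1.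
    rewrite <- !RtoC_mult, <- !RtoC_plus, Re_RtoC_div in HQ.
    unfold v. rewrite <- PSeries_INR.
    rewrite (PSeries_ext _ (fun n => (1 - tau) * (INR n * u kappa n)
                                     + tau * (INR n * u (S kappa) n)))
      by (intros n; ring).
    rewrite !PSeries_comb, !PSeries_INR by (try apply unit_radius_INR; auto).
    replace ((1 - tau) * (y * PSeries (PS_derive (u kappa)) y) +
       tau * (y * PSeries (PS_derive (u (S kappa))) y)) with
      ((1 - tau) * y * PSeries (PS_derive (u kappa)) y +
       tau * y * PSeries (PS_derive (u (S kappa))) y) by ring.
    exact HQ. }
  assert (HB : 0 < PSeries v x).
  { apply PSeries_pos_of_nonzero; auto.
    (* At a zero of the denominator the quotient is 0 by convention, against [0 <= eta]. *)
    intros y Hy E; specialize (Hquot y Hy).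
    rewrite E in Hquot; unfold Rdiv in Hquot; rewrite Rinv_0, Rmult_0_r in Hquot; lra. }
  assert (Hx1 : Rabs x < 1) by (rewrite Rabs_pos_eq; lra).
  rewrite <- (PSeries_ext _ _ x Hw).
  rewrite PSeries_comb, PSeries_INR by (try apply unit_radius_INR; auto).
  specialize (Hquot x Hx).
  apply (Rmult_lt_compat_r _ _ _ HB) in Hquot.
  unfold Rdiv in Hquot; rewrite Rmult_assoc, Rinv_l in Hquot by lra; lra.
Qed.

Lemma sum_n_le_Series (a : nat -> R) (N : nat) :
  (forall n, 0 <= a n) -> ex_series a -> sum_n a N <= Series a.
Proof.
  intros H Hex.
  rewrite (Series_incr_n a (S N)); [| lia | exact Hex].
  rewrite sum_n_Reals; simpl.
  assert (0 <= Series (fun k => a (S N + k)%nat)); [| simpl in *; lra].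
  rewrite <- (Rmult_0_l (Series (fun _ => 0))), <- Series_scal_l.
  apply Series_le; [intros n; rewrite Rmult_0_l; split; [apply Rle_refl | apply H] |].
  now apply (ex_series_incr_n a (S N)).
Qed.

Lemma classP_coef_sum (p q tau eta : R) (xi kappa : nat) (f : C -> C) (c : nat -> R) (N : nat) :
  0 < p -> p < q -> q <= 1 -> 0 <= eta -> eta < 1 ->
  (forall n : nat, (2 <= n)%nat ->
     weight p q xi kappa tau eta n <= weight p q xi kappa tau eta (S n)) ->
  0 < weight p q xi kappa tau eta 2 ->
  classQ p q xi kappa tau eta f ->
  unit_radius (T_coef c) ->
  (forall n : nat, (2 <= n)%nat -> 0 <= c n) ->
  (forall t, Rabs t < 1 -> f (RtoC t) = RtoC (PSeries (T_coef c) t)) ->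
  sum_n (fun k => c (k + 2)%nat) N <= (1 - eta) / weight p q xi kappa tau eta 2.
Proof.
  intros hp hpq hq heta heta1 hmono hpos HQ Ha Hc Hf.
  set (W := weight p q xi kappa tau eta) in *.
  apply Rmult_le_reg_l with (1 := hpos).
  replace (W 2%nat * ((1 - eta) / W 2%nat)) with (1 - eta) by (field; lra).
  apply (pow_mult_le_limit (N + 2)); intros x Hx.
  destruct (classQ_real p q tau eta xi kappa f (T_coef c) x hp hpq hq heta HQ Ha
    eq_refl eq_refl Hf Hx) as [Hr Hp].
  fold W in Hr, Hp.
  assert (Hx1 : Rabs x < 1) by (rewrite Rabs_pos_eq; lra).
  assert (HW1 : W 1%nat = 1 - eta).
  { unfold W, weight; rewrite pqnum_1 by exact hpq; simpl.
    replace (1 + (1 - 1) * tau) with 1 by ring; rewrite !pow1; ring. }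
  clearbody W.
  set (b := fun k => W (k + 2)%nat * c (k + 2)%nat * x ^ (k + 2)).
  assert (Hb : forall k, 0 <= b k).
  { intros k; unfold b. repeat apply Rmult_le_pos.
    - apply Rle_trans with (W 2%nat); [lra | apply nondecreasing_from; [exact hmono | lia]].
    - apply Hc; lia.
    - apply pow_le; lra. }
  assert (Hex0 : ex_series (fun k => W k * T_coef c k * x ^ k))
    by (apply ex_pseries_R, CV_radius_inside; now apply unit_radius_lt).
  assert (Hex : ex_series b).
  { apply (ex_series_incr_n _ 2) in Hex0.
    apply ex_series_ext with (2 := ex_series_scal_l (-1) _ Hex0).
    intros k; unfold b; rewrite (Nat.add_comm k 2); unfold scal; simpl; unfold mult; simpl; ring. }
  assert (HP : PSeries (fun n => W n * T_coef c n) x = (1 - eta) * x - Series b).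
  { unfold PSeries. rewrite (Series_incr_n _ 2); [| lia | exact Hex0].
    simpl sum_f_R0. rewrite HW1.
    rewrite (Series_ext _ (fun k => (-1) * b k)).
    - rewrite Series_scal_l; simpl; ring.
    - intros k; unfold b; rewrite (Nat.add_comm k 2); simpl; ring. }
  assert (Hs := sum_n_le_Series b N Hb Hex).
  apply Rle_trans with (sum_n b N); [| nra].
  rewrite <- Rmult_assoc.
  rewrite !sum_n_Reals, scal_sum. apply sum_Rle; intros k Hk.
  rewrite Rmult_comm; unfold b.
  rewrite (Rmult_comm (x ^ _)), (Rmult_assoc (W 2%nat)), (Rmult_assoc (W (k + 2)%nat)).
  assert (0 <= c (k + 2)%nat) by (apply Hc; lia).
  assert (0 <= x ^ (N + 2)) by (apply pow_le; lra).
  apply Rmult_le_compat; [lra | now apply Rmult_le_pos | apply nondecreasing_from; [exact hmono | lia] |].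
  rewrite Rmult_comm; apply Rmult_le_compat_l; [assumption |].
  replace (N + 2)%nat with (k + 2 + (N - k))%nat by lia.
  rewrite pow_add. rewrite <- Rmult_1_r.
  apply Rmult_le_compat_l; [apply pow_le; lra |].
  rewrite <- (pow1 (N - k)); apply pow_incr; lra.
Qed.

(** * The binomial series *)

(** The Taylor coefficients of [(1 - x)^s], that is [(-1)^k] times the binomial coefficient of [s]
    and [k]. *)
Fixpoint binom_coef (s : R) (k : nat) : R :=
  match k with
  | O => 1
  | S j => binom_coef s j * ((INR j - s) / (INR j + 1))
  end.

(** The factor [|j - s| / (j + 1)] is at most 1 once [j >= s] and at most [1 + s] before that, so
    only the first [m >= s] factors can contribute growth. A bound is enough, since the series is
    evaluated only at points of modulus less than 1. *)
Lemma binom_coef_bounded (s : R) :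
  0 < s -> exists M, forall k, Rabs (binom_coef s k) <= M.
Proof.
  intros Hs.
  destruct (nfloor_ex s (Rlt_le _ _ Hs)) as [m0 [_ Hm0]].
  set (m := S m0). assert (Hm : s <= INR m) by (unfold m; rewrite S_INR; lra).
  assert (H1 : forall j k, (j <= k)%nat -> (1 + s) ^ j <= (1 + s) ^ k)
    by (intros j k Hjk; apply Rle_pow; [lra | exact Hjk]).
  exists ((1 + s) ^ m).
  assert (H : forall k, Rabs (binom_coef s k) <= (1 + s) ^ (Nat.min k m)).
  { induction k as [| k IH]; simpl binom_coef.
    - rewrite Rabs_R1; simpl; lra.
    - assert (Hk := pos_INR k).
      rewrite Rabs_mult, Rabs_div, (Rabs_pos_eq (INR k + 1)) by lra.
      destruct (Nat.le_gt_cases m k) as [Hmk | Hmk].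
      + rewrite Nat.min_r in * by lia.
        assert (s <= INR k) by (apply Rle_trans with (1 := Hm), le_INR, Hmk).
        rewrite <- Rmult_1_r. apply Rmult_le_compat; [apply Rabs_pos | | exact IH |].
        * apply Rdiv_le_0_compat; [apply Rabs_pos | lra].
        * apply Rle_div_l; [lra |]. rewrite Rabs_pos_eq; lra.
      + rewrite Nat.min_l in * by lia. rewrite <- tech_pow_Rmult, Rmult_comm.
        apply Rmult_le_compat; [| apply Rabs_pos | | exact IH].
        * apply Rdiv_le_0_compat; [apply Rabs_pos | lra].
        * apply Rle_div_l; [lra |]. apply Rabs_le; split; nra. }
  intros k; apply Rle_trans with (1 := H k), H1; lia.
Qed.

(** [|U + i V|^2] and [|1 - t e|^(2 s)] solve the same linear differential
    equation when [(1 - t e) W' = - s e W] for [W = U + i V]. *)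
Lemma binomial_ode (U V U' V' : R -> R) (er ei s b : R) :
  0 < b < 1 -> er ^ 2 + ei ^ 2 <= 1 ->
  (forall t, 0 <= t <= b -> is_derive U t (U' t)) ->
  (forall t, 0 <= t <= b -> is_derive V t (V' t)) ->
  (forall t, 0 <= t <= b ->
     U' t = er * (t * U' t - s * U t) - ei * (t * V' t - s * V t)) ->
  (forall t, 0 <= t <= b ->
     V' t = er * (t * V' t - s * V t) + ei * (t * U' t - s * U t)) ->
  U 0 = 1 -> V 0 = 0 ->
  U b ^ 2 + V b ^ 2 = Rpower ((1 - b * er) ^ 2 + (b * ei) ^ 2) s.
Proof.
  intros Hb He HU HV EU EV U0 V0.
  set (D := fun t => (1 - t * er) ^ 2 + (t * ei) ^ 2).
  assert (HD : forall t, 0 <= t <= b -> 0 < D t).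
  { intros t Ht; unfold D.
    assert (er <= 1) by nra. assert (0 < 1 - t * er) by nra.
    generalize (pow_lt _ 2 H0) (pow2_ge_0 (t * ei)); lra. }
  (* The quotient of the two solutions, [|W|^2 * D^(-s)]; it is constant and equals 1 at [t = 0]. *)
  set (G := fun t => (U t ^ 2 + V t ^ 2) * exp (- s * ln (D t))).
  assert (HG : forall t, 0 <= t <= b -> is_derive G t 0).
  { intros t Ht.
    assert (Hdt := HD t Ht).
    assert (dU := HU t Ht). assert (dV := HV t Ht).
    unfold G, D. auto_derive.
    - repeat split; try (eexists; eassumption). unfold D in Hdt; exact Hdt.
    - assert (DU : Derive (fun y => U y) t = U' t) by exact (is_derive_unique _ _ _ dU).
      assert (DV : Derive (fun y => V y) t = V' t) by exact (is_derive_unique _ _ _ dV).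
      rewrite DU, DV.
      match goal with |- context [ln ?d] =>
        replace d with (D t) by (unfold D; ring) end.
      specialize (EU t Ht). specialize (EV t Ht).
      (* [E1] and [E2] are the real and imaginary parts of [(1 - t e) W' = - s e W]. Multiplying by
         the conjugates of [1 - t e] and of [W] and taking real parts gives [K], half of
         [D (|W|^2)']. *)
      assert (K : D t * (U t * U' t + V t * V' t)
                  = - s * (er * (1 - t * er) - t * ei ^ 2) * (U t ^ 2 + V t ^ 2)).
      { assert (E1 : (1 - t * er) * U' t + t * ei * V' t = - s * (er * U t - ei * V t)) by lra.
        assert (E2 : (1 - t * er) * V' t - t * ei * U' t = - s * (ei * U t + er * V t)) by lra.
        replace (D t * (U t * U' t + V t * V' t)) with
          (U t * ((1 - t * er) * ((1 - t * er) * U' t + t * ei * V' t)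
                  - t * ei * ((1 - t * er) * V' t - t * ei * U' t))
           + V t * (t * ei * ((1 - t * er) * U' t + t * ei * V' t)
                  + (1 - t * er) * ((1 - t * er) * V' t - t * ei * U' t)))
          by (unfold D; ring).
        rewrite E1, E2; ring. }
      apply Rmult_eq_reg_l with (D t); [| lra].
      rewrite Rmult_0_r.
      transitivity (2 * exp (- s * ln (D t)) *
        (D t * (U t * U' t + V t * V' t)
         + s * (er * (1 - t * er) - t * ei ^ 2) * (U t ^ 2 + V t ^ 2))).
      + field. lra.
      + rewrite K; ring. }
  assert (E : G 0 = G b).
  { apply (eq_is_derive (V := R_NormedModule) G 0 b); [exact HG | lra]. }
  unfold G in E. rewrite U0, V0 in E.
  replace (D 0) with 1 in E by (unfold D; ring).
  rewrite ln_1, Rmult_0_r, exp_0 in E.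
  unfold Rpower. fold (D b).
  replace (- s * ln (D b)) with (- (s * ln (D b))) in E by ring.
  rewrite exp_Ropp in E.
  assert (Hexp := exp_pos (s * ln (D b))).
  apply Rmult_eq_reg_r with (/ exp (s * ln (D b))); [| apply Rinv_neq_0_compat; lra].
  rewrite Rinv_r by lra. lra.
Qed.

(** * Power series with real coefficients at a complex argument *)

Definition rps (h : nat -> R) (x : C) : C := CSeries (fun k => RtoC (h k) * x ^ k)%C.

Lemma Rabs_Re_le (x : C) : Rabs (Re x) <= Cmod x.
Proof. apply Rle_trans with (2 := Rmax_Cmod x), Rmax_l. Qed.

Lemma Rabs_Im_le (x : C) : Rabs (Im x) <= Cmod x.
Proof. apply Rle_trans with (2 := Rmax_Cmod x), Rmax_r. Qed.

Lemma Cmod_le_abs (x : C) : Cmod x <= Rabs (Re x) + Rabs (Im x).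
Proof.
  replace x with (RtoC (Re x) + Ci * RtoC (Im x))%C.
  - apply Rle_trans with (1 := Cmod_triangle _ _).
    rewrite Cmod_mult, Cmod_Ci, !Cmod_R. 
    destruct x as [u v]; simpl. unfold Re, Im; simpl.
    replace (u + (0 * v - 1 * 0)) with u by ring.
    replace (0 + (0 * 0 + 1 * v)) with v by ring. lra.
  - destruct x as [u v]; apply injective_projections; unfold Re, Im; simpl; ring.
Qed.

Lemma rps_term (h : nat -> R) (M b : R) (x : C) (k : nat) :
  (forall k, Rabs (h k) <= M) -> Cmod x <= b ->
  Cmod (RtoC (h k) * x ^ k)%C <= M * b ^ k.
Proof.
  intros Hh Hx.
  rewrite Cmod_mult, Cmod_R, Cmod_pow.
  apply Rmult_le_compat; [apply Rabs_pos | apply pow_le, Cmod_ge_0 | apply Hh |].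
  apply pow_incr; split; [apply Cmod_ge_0 | exact Hx].
Qed.

Lemma geom_scal (M b : R) :
  0 <= b < 1 ->
  ex_series (fun k => M * b ^ k) /\ Series (fun k => M * b ^ k) = M / (1 - b).
Proof.
  intros Hb. assert (Hb1 : Rabs b < 1) by (rewrite Rabs_pos_eq; lra).
  split.
  - apply (ex_series_scal_l M (fun k => b ^ k)), ex_series_geom, Hb1.
  - rewrite Series_scal_l, Series_geom by exact Hb1; reflexivity.
Qed.

Lemma rps_ex_Re (h : nat -> R) (M b : R) (x : C) :
  (forall k, Rabs (h k) <= M) -> 0 <= b < 1 -> Cmod x <= b ->
  ex_series (fun k => Re (RtoC (h k) * x ^ k)%C).
Proof.
  intros Hh Hb Hx.
  apply (ex_series_le (V := R_CompleteNormedModule)) with (2 := proj1 (geom_scal M b Hb)).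
  intros k; apply Rle_trans with (2 := rps_term h M b x k Hh Hx), Rabs_Re_le.
Qed.

Lemma rps_ex_Im (h : nat -> R) (M b : R) (x : C) :
  (forall k, Rabs (h k) <= M) -> 0 <= b < 1 -> Cmod x <= b ->
  ex_series (fun k => Im (RtoC (h k) * x ^ k)%C).
Proof.
  intros Hh Hb Hx.
  apply (ex_series_le (V := R_CompleteNormedModule)) with (2 := proj1 (geom_scal M b Hb)).
  intros k; apply Rle_trans with (2 := rps_term h M b x k Hh Hx), Rabs_Im_le.
Qed.

(** The factor 2 appears because [CSeries] sums real and imaginary parts separately and each is
    compared with the geometric series. *)
Lemma rps_bound (h : nat -> R) (M b : R) (x : C) :
  (forall k, Rabs (h k) <= M) -> 0 <= b < 1 -> Cmod x <= b ->
  Cmod (rps h x) <= 2 * (M / (1 - b)).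
Proof.
  intros Hh Hb Hx.
  apply Rle_trans with (1 := Cmod_le_abs _).
  assert (H : forall u : nat -> R, (forall k, Rabs (u k) <= M * b ^ k) ->
    Rabs (Series u) <= M / (1 - b)).
  { intros u Hu. rewrite <- (proj2 (geom_scal M b Hb)).
    assert (ex_series (fun k => Rabs (u k))).
    { apply (ex_series_le (V := R_CompleteNormedModule)) with (2 := proj1 (geom_scal M b Hb)).
      intros k; change (Rabs (Rabs (u k)) <= M * b ^ k).
      now rewrite Rabs_Rabsolu. }
    apply Rle_trans with (1 := Series_Rabs u H).
    apply Series_le; [| exact (proj1 (geom_scal M b Hb))].
    intros k; split; [apply Rabs_pos | apply Hu]. }
  replace (2 * (M / (1 - b))) with (M / (1 - b) + M / (1 - b)) by ring.
  apply Rplus_le_compat; apply H; intros k; apply Rle_trans with (2 := rps_term h M b x k Hh Hx).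
  - apply Rabs_Re_le.
  - apply Rabs_Im_le.
Qed.

Lemma rps_step (h : nat -> R) (M b : R) (x : C) :
  (forall k, Rabs (h k) <= M) -> 0 <= b < 1 -> Cmod x <= b ->
  rps h x = (RtoC (h 0%nat) + x * rps (fun k => h (S k)) x)%C.
Proof.
  intros Hh Hb Hx.
  assert (Hh' : forall k, Rabs (h (S k)) <= M) by (intros k; apply Hh).
  assert (HR := rps_ex_Re (fun k => h (S k)) M b x Hh' Hb Hx).
  assert (HI := rps_ex_Im (fun k => h (S k)) M b x Hh' Hb Hx).
  assert (E : forall k, (RtoC (h (S k)) * x ^ S k)%C
                        = (x * (RtoC (h (S k)) * x ^ k))%C)
    by (intros k; rewrite Cpow_S; ring).
  unfold rps, CSeries. apply injective_projections.
  - cbn [fst snd]. rewrite Series_incr_1 by now apply (rps_ex_Re h M b).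
    rewrite (Series_ext (fun k => Re (RtoC (h (S k)) * x ^ S k)%C)
      (fun k => Re x * Re (RtoC (h (S k)) * x ^ k)%C
                + - Im x * Im (RtoC (h (S k)) * x ^ k)%C))
      by (intros k; rewrite E, re_mult; ring).
    rewrite Series_plus, !Series_scal_l
      by (now apply (ex_series_scal_l (V := R_NormedModule) _ _)).
    simpl; unfold Re, Im; ring.
  - cbn [fst snd]. rewrite Series_incr_1 by now apply (rps_ex_Im h M b).
    rewrite (Series_ext (fun k => Im (RtoC (h (S k)) * x ^ S k)%C)
      (fun k => Re x * Im (RtoC (h (S k)) * x ^ k)%C
                + Im x * Re (RtoC (h (S k)) * x ^ k)%C))
      by (intros k; rewrite E, im_mult; ring).
    rewrite Series_plus, !Series_scal_l
      by (now apply (ex_series_scal_l (V := R_NormedModule) _ _)).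
    simpl; unfold Re, Im; ring.
Qed.

(** Horner form: recursion on the shifted sequence is the splitting [P 0 + z Q] on which the
    orthogonality induction runs. *)
Fixpoint rpoly (h : nat -> R) (n : nat) (x : C) : C :=
  match n with
  | O => RtoC (h 0%nat)
  | S m => (RtoC (h 0%nat) + x * rpoly (fun k => h (S k)) m x)%C
  end.

(** Series and truncation obey the same Horner step, so their difference gains one factor [x] per
    step; shifting [h] preserves the bound [M], which controls the remaining tail. *)
Lemma rps_rpoly (M b : R) (n : nat) (h : nat -> R) (x : C) :
  (forall k, Rabs (h k) <= M) -> 0 <= b < 1 -> Cmod x <= b ->
  Cmod (rps h x - rpoly h n x) <= b ^ S n * (2 * (M / (1 - b))).
Proof.
  intros Hh Hb Hx; revert h Hh.
  assert (HB : forall h, (forall k, Rabs (h k) <= M) -> Cmod (rps h x) <= 2 * (M / (1 - b)))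
    by (intros h Hh; now apply rps_bound).
  induction n as [| n IH]; intros h Hh; simpl rpoly;
    rewrite (rps_step h M b x Hh Hb Hx).
  - replace (_ - _)%C with (x * rps (fun k => h (S k)) x)%C by ring.
    rewrite Cmod_mult, pow_1.
    apply Rmult_le_compat; try apply Cmod_ge_0; [exact Hx | apply HB; intros k; apply Hh].
  - replace (_ - _)%C
      with (x * (rps (fun k => h (S k)) x - rpoly (fun k => h (S k)) n x))%C by ring.
    rewrite Cmod_mult, <- (tech_pow_Rmult b (S n)), Rmult_assoc.
    apply Rmult_le_compat; try apply Cmod_ge_0; [exact Hx | apply IH; intros k; apply Hh].
Qed.

(** Along the segment [t * e] the real and imaginary parts of the series are real power series in
    [t], and the recursion [(k + 1) h (k + 1) = (k - s) h k] is the differential equation of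
    [binomial_ode]. *)
Lemma binomial_modulus (s : R) (x : C) :
  0 < s -> Cmod x < 1 ->
  Cmod (rps (binom_coef s) x) ^ 2 = Rpower (Cmod (1 - x)%C ^ 2) s.
Proof.
  intros Hs Hx.
  destruct (binom_coef_bounded s Hs) as [M HM].
  (* Strictly between 0 and 1 even for [x = 0], so [x] can be divided by it. *)
  set (b := (1 + Cmod x) / 2).
  assert (Hb : 0 < b < 1) by (generalize (Cmod_ge_0 x); unfold b; lra).
  assert (Hxb : Cmod x <= b) by (unfold b; lra).
  set (e := (x / RtoC b)%C).
  assert (Hb0 : RtoC b <> 0) by (intros E; apply RtoC_inj in E; lra).
  assert (Hxe : x = (RtoC b * e)%C) by (unfold e; field; exact Hb0).
  assert (He : Cmod e <= 1).
  { unfold e; rewrite Cmod_div, Cmod_R, Rabs_pos_eq by (exact Hb0 || lra).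
    apply Rle_div_l; lra. }
  set (h := binom_coef s) in *.
  assert (Hpow : forall k, Cmod (e ^ k)%C <= 1).
  { intros k; rewrite Cmod_pow, <- (pow1 k). apply pow_incr; split; [apply Cmod_ge_0 | exact He]. }
  assert (Hrad : forall u, (forall k, Rabs (u k) <= 1) -> unit_radius (fun k => h k * u k)).
  { intros u Hu. apply unit_radius_bounded; intros y Hy. exists M; intros k.
    rewrite !Rabs_mult. rewrite <- (Rmult_1_r M).
    rewrite <- (Rmult_1_r (M * 1)) at 1.
    assert (0 <= y ^ k <= 1).
    { split; [apply pow_le; lra |]. rewrite <- (pow1 k); apply pow_incr; lra. }
    rewrite (Rabs_pos_eq (y ^ k)) by lra.
    assert (HMk := HM k). assert (Huk := Hu k).
    assert (H0 := Rabs_pos (h k)). assert (H1 := Rabs_pos (u k)).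
    assert (Rabs (h k) * Rabs (u k) <= M * 1) by (apply Rmult_le_compat; assumption).
    assert (0 <= Rabs (h k) * Rabs (u k)) by (now apply Rmult_le_pos).
    rewrite Rmult_1_r in *. nra. }
  set (alpha := fun k => h k * Re (e ^ k)%C).
  set (beta := fun k => h k * Im (e ^ k)%C).
  assert (Ra : unit_radius alpha)
    by (apply Hrad; intros k; apply Rle_trans with (1 := Rabs_Re_le _), Hpow).
  assert (Rb : unit_radius beta)
    by (apply Hrad; intros k; apply Rle_trans with (1 := Rabs_Im_le _), Hpow).
  assert (Hlt : forall t, 0 <= t <= b -> Rabs t < 1)
    by (intros t Ht; rewrite Rabs_pos_eq; lra).
  assert (Hstep : forall k, INR (S k) * h (S k) = (INR k - s) * h k).
  { intros k; unfold h; simpl binom_coef; rewrite S_INR; field.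
    generalize (pos_INR k); lra. }
  assert (Hcomb : forall t, 0 <= t <= b -> forall u, unit_radius u ->
    PSeries (fun n => 1 * (INR n * u n) + - s * u n) t
    = t * PSeries (PS_derive u) t - s * PSeries u t).
  { intros t Ht u Hu. rewrite PSeries_comb, PSeries_INR
      by (try apply unit_radius_INR; auto). ring. }
  assert (Hru : forall u, unit_radius u ->
    unit_radius (fun n => 1 * (INR n * u n) + - s * u n))
    by (intros u Hu; apply unit_radius_comb; [now apply unit_radius_INR | exact Hu]).
  assert (Hode := binomial_ode (PSeries alpha) (PSeries beta)
    (PSeries (PS_derive alpha)) (PSeries (PS_derive beta)) (Re e) (Im e) s b Hb).
  replace (Cmod (1 - x)%C ^ 2) with ((1 - b * Re e) ^ 2 + (b * Im e) ^ 2).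
  2: { rewrite Cmod2_alt, Hxe. destruct e as [u v]; unfold Re, Im; simpl; ring. }
  rewrite <- Hode.
  - assert (E : forall k, (RtoC (h k) * x ^ k)%C = (RtoC (h k * b ^ k) * e ^ k)%C).
    { intros k. rewrite Hxe, Cpow_mult_l, <- RtoC_pow, RtoC_mult; ring. }
    replace (rps h x) with ((PSeries alpha b, PSeries beta b) : C);
      [now rewrite Cmod2_alt |].
    unfold rps, CSeries, PSeries; f_equal; apply Series_ext; intros k;
      rewrite E, ?re_scal_l, ?im_scal_l; unfold alpha, beta; ring.
  - rewrite <- Cmod2_alt. rewrite <- (pow1 2). apply pow_incr; split; [apply Cmod_ge_0 | exact He].
  - intros t Ht; apply is_derive_PSeries, unit_radius_lt; auto.
  - intros t Ht; apply is_derive_PSeries, unit_radius_lt; auto.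
  - intros t Ht. rewrite <- !Hcomb by auto.
    replace (_ - _) with (Re e * PSeries (fun n => 1 * (INR n * alpha n) + - s * alpha n) t
      + - Im e * PSeries (fun n => 1 * (INR n * beta n) + - s * beta n) t) by ring.
    rewrite <- PSeries_comb by auto. apply PSeries_ext; intros k.
    transitivity (INR (S k) * h (S k) * Re (e * e ^ k)%C).
    + unfold PS_derive, alpha; rewrite Cpow_S; ring.
    + rewrite Hstep, re_mult; unfold alpha, beta; ring.
  - intros t Ht. rewrite <- !Hcomb by auto.
    rewrite <- PSeries_comb by auto. apply PSeries_ext; intros k.
    transitivity (INR (S k) * h (S k) * Im (e * e ^ k)%C).
    + unfold PS_derive, beta; rewrite Cpow_S; ring.
    + rewrite Hstep, im_mult; unfold alpha, beta; ring.
  - rewrite PSeries_0; unfold alpha, h; simpl; ring.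
  - rewrite PSeries_0; unfold beta; simpl; ring.
Qed.

(** * Trigonometric polynomials without constant term *)

(** Boundary values of real polynomials vanishing at the origin: only frequencies [S n] occur, so
    the class is closed under products and every mean is 0. The third constructor allows rewriting
    up to pointwise equality. *)
Inductive trigpoly : (R -> C) -> Prop :=
| trigpoly_mono (c : R) (n : nat) :
    trigpoly (fun t => (c * cos (INR (S n) * t), c * sin (INR (S n) * t)))
| trigpoly_plus (f g : R -> C) :
    trigpoly f -> trigpoly g -> trigpoly (fun t => f t + g t)%C
| trigpoly_ext (f g : R -> C) :
    (forall t, f t = g t) -> trigpoly f -> trigpoly g.

Lemma trigpoly_mult (f g : R -> C) :
  trigpoly f -> trigpoly g -> trigpoly (fun t => f t * g t)%C.
Proof.
  intros Hf; revert g; induction Hf as [c n | f1 f2 _ IH1 _ IH2 | f1 f2 E _ IH].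
  - intros g Hg; induction Hg as [d m | g1 g2 _ IH1 _ IH2 | g1 g2 E _ IH].
    + apply trigpoly_ext with (2 := trigpoly_mono (c * d) (S (n + m))).
      intros t.
      replace (INR (S (S (n + m))) * t) with (INR (S n) * t + INR (S m) * t)
        by (rewrite !S_INR, plus_INR; ring).
      rewrite cos_plus, sin_plus.
      apply injective_projections; simpl; ring.
    + apply trigpoly_ext with (2 := trigpoly_plus _ _ IH1 IH2); intros t; simpl; ring.
    + apply trigpoly_ext with (2 := IH); intros t; now rewrite E.
  - intros g Hg. apply trigpoly_ext with (2 := trigpoly_plus _ _ (IH1 g Hg) (IH2 g Hg)).
    intros t; simpl; ring.
  - intros g Hg. apply trigpoly_ext with (2 := IH g Hg); intros t; now rewrite E.
Qed.

Lemma trigpoly_scal (r : R) (f : R -> C) :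
  trigpoly f -> trigpoly (fun t => RtoC r * f t)%C.
Proof.
  intros Hf; induction Hf as [c n | f1 f2 _ IH1 _ IH2 | f1 f2 E _ IH].
  - apply trigpoly_ext with (2 := trigpoly_mono (r * c) n).
    intros t; apply injective_projections; simpl; ring.
  - apply trigpoly_ext with (2 := trigpoly_plus _ _ IH1 IH2); intros t; simpl; ring.
  - apply trigpoly_ext with (2 := IH); intros t; now rewrite E.
Qed.

Lemma trigpoly_circle (r : R) : trigpoly (circle r).
Proof.
  apply trigpoly_ext with (2 := trigpoly_mono r 0); intros t; unfold circle.
  now rewrite Rmult_1_l.
Qed.

Lemma trigpoly_mean_zero (f : R -> C) :
  trigpoly f -> is_RInt (fun t => Re (f t)) 0 (2 * PI) 0.
Proof.
  intros Hf; induction Hf as [c n | f1 f2 _ IH1 _ IH2 | f1 f2 E _ IH].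
  - assert (Hn : INR (S n) <> 0) by (apply not_0_INR; discriminate).
    set (F := fun t => c / INR (S n) * sin (INR (S n) * t)).
    replace 0 with (minus (F (2 * PI)) (F 0)) at 2.
    + apply (is_RInt_derive F).
      * intros t _; unfold F; auto_derive; [exact I |]. simpl Re. field. exact Hn.
      * intros t _. simpl Re. apply (ex_derive_continuous (V := R_NormedModule)).
        auto_derive; exact I.
    + change (F (2 * PI) + - F 0 = 0); unfold F.
      replace (INR (S n) * (2 * PI)) with (0 + 2 * INR (S n) * PI) by ring.
      rewrite sin_period, Rmult_0_r, sin_0; ring.
  - replace 0 with (plus 0 0) at 2 by (unfold plus; simpl; ring).
    exact (is_RInt_plus _ _ _ _ _ _ IH1 IH2).
  - apply is_RInt_ext with (2 := IH); intros t _; now rewrite E.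
Qed.

(** * Continuity on the circle and the inequality for polynomials *)

Definition Ccont (f : R -> C) : Prop :=
  forall t, continuity_pt (fun u => Re (f u)) t /\ continuity_pt (fun u => Im (f u)) t.

Lemma Ccont_const (c : C) : Ccont (fun _ => c).
Proof. intros t; split; apply continuity_pt_const; intros u v; reflexivity. Qed.

Lemma Ccont_plus (f g : R -> C) : Ccont f -> Ccont g -> Ccont (fun t => f t + g t)%C.
Proof.
  intros Hf Hg t; destruct (Hf t), (Hg t); split; simpl.
  - now apply (continuity_pt_plus (fun u => Re (f u)) (fun u => Re (g u))).
  - now apply (continuity_pt_plus (fun u => Im (f u)) (fun u => Im (g u))).
Qed.

Lemma Ccont_mult (f g : R -> C) : Ccont f -> Ccont g -> Ccont (fun t => f t * g t)%C.
Proof.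
  intros Hf Hg t; destruct (Hf t), (Hg t); split.
  - apply (continuity_pt_minus (fun u => Re (f u) * Re (g u)) (fun u => Im (f u) * Im (g u)));
      now apply continuity_pt_mult.
  - apply (continuity_pt_plus (fun u => Re (f u) * Im (g u)) (fun u => Im (f u) * Re (g u)));
      now apply continuity_pt_mult.
Qed.

Lemma Ccont_minus (f g : R -> C) : Ccont f -> Ccont g -> Ccont (fun t => f t - g t)%C.
Proof.
  intros Hf Hg t; destruct (Hf t), (Hg t); split; simpl.
  - now apply (continuity_pt_minus (fun u => Re (f u)) (fun u => Re (g u))).
  - now apply (continuity_pt_minus (fun u => Im (f u)) (fun u => Im (g u))).
Qed.

Lemma Ccont_trigpoly (f : R -> C) : trigpoly f -> Ccont f.
Proof.
  intros Hf; induction Hf as [c n | f1 f2 _ IH1 _ IH2 | f1 f2 E _ IH].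
  - intros t; split; simpl Re; simpl Im; reg.
  - now apply Ccont_plus.
  - now rewrite <- (functional_extensionality f1 f2 E).
Qed.

Lemma continuity_Cmod (f : R -> C) : Ccont f -> continuity (fun t => Cmod (f t)).
Proof.
  intros Hf t; destruct (Hf t) as [H1 H2].
  apply (continuity_pt_comp (fun u => Re (f u) ^ 2 + Im (f u) ^ 2) sqrt).
  - apply (continuity_pt_plus (fun u => Re (f u) ^ 2) (fun u => Im (f u) ^ 2));
      simpl; repeat apply continuity_pt_mult; auto; apply continuity_pt_const; intros u v; reflexivity.
  - apply continuity_pt_sqrt. generalize (pow2_ge_0 (Re (f t))) (pow2_ge_0 (Im (f t))); lra.
Qed.

Lemma ex_RInt_continuity (f : R -> R) (a b : R) : continuity f -> ex_RInt f a b.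
Proof.
  intros Hf; apply (ex_RInt_continuous (V := R_CompleteNormedModule)); intros t _.
  apply continuity_pt_filterlim, Hf.
Qed.

Lemma continuity_pow2 (f : R -> R) : continuity f -> continuity (fun t => f t ^ 2).
Proof.
  intros Hf t; simpl; repeat apply continuity_pt_mult; auto;
    apply continuity_pt_const; intros u v; reflexivity.
Qed.

Lemma Ccont_rpoly (f : R -> C) (n : nat) (h : nat -> R) :
  Ccont f -> Ccont (fun t => rpoly h n (f t)).
Proof.
  intros Hf; revert h; induction n as [| n IH]; intros h; simpl; [apply Ccont_const |].
  apply Ccont_plus; [apply Ccont_const | apply Ccont_mult; [exact Hf | apply IH]].
Qed.

Lemma trigpoly_rpoly (f : R -> C) (n : nat) (h : nat -> R) :
  trigpoly f -> trigpoly (fun t => f t * rpoly h n (f t))%C.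
Proof.
  intros Hf; revert h; induction n as [| n IH]; intros h; simpl.
  - apply trigpoly_ext with (2 := trigpoly_scal (h 0%nat) f Hf); intros t; ring.
  - apply trigpoly_ext with (2 := trigpoly_plus _ _ (trigpoly_scal (h 0%nat) f Hf)
      (trigpoly_mult _ _ Hf (IH (fun k => h (S k))))).
    intros t; simpl; ring.
Qed.

Lemma Cmod_circle (r t : R) : 0 <= r -> Cmod (circle r t) = r.
Proof.
  intros Hr; unfold Cmod, circle; simpl fst; simpl snd.
  replace ((r * cos t) ^ 2 + (r * sin t) ^ 2) with (r ^ 2); [now apply sqrt_pow2 |].
  generalize (sin2_cos2 t); unfold Rsqr; intros E.
  transitivity (r ^ 2 * (sin t * sin t + cos t * cos t)); [rewrite E |]; ring.
Qed.

(** Orthogonality: the constant term of [rpoly h] is orthogonal to the rest. *)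
Lemma RInt_rpoly_S (f : R -> C) (n : nat) (h : nat -> R) :
  trigpoly f ->
  RInt (fun t => Cmod (rpoly h (S n) (f t)) ^ 2) 0 (2 * PI)
  = 2 * PI * h 0%nat ^ 2
    + RInt (fun t => Cmod (f t) ^ 2 * Cmod (rpoly (fun k => h (S k)) n (f t)) ^ 2) 0 (2 * PI).
Proof.
  intros Hf. set (g := fun t => rpoly (fun k => h (S k)) n (f t)).
  assert (Hc : Ccont f) by now apply Ccont_trigpoly.
  assert (Hg : Ccont g) by now apply Ccont_rpoly.
  assert (Hz := trigpoly_mean_zero _ (trigpoly_rpoly f n (fun k => h (S k)) Hf)).
  apply is_RInt_unique.
  assert (Hint : ex_RInt (fun t => Cmod (f t) ^ 2 * Cmod (g t) ^ 2) 0 (2 * PI)).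
  { apply ex_RInt_continuity.
    apply (continuity_mult (fun t => Cmod (f t) ^ 2) (fun t => Cmod (g t) ^ 2));
      apply continuity_pow2; now apply continuity_Cmod. }
  apply (RInt_correct (V := R_CompleteNormedModule)) in Hint.
  assert (H1 := is_RInt_const (V := R_NormedModule) 0 (2 * PI) (h 0%nat ^ 2)).
  assert (H2 := is_RInt_scal (V := R_NormedModule) _ 0 (2 * PI) (2 * h 0%nat) _ Hz).
  assert (H3 := is_RInt_plus _ _ _ _ _ _ (is_RInt_plus _ _ _ _ _ _ H1 H2) Hint).
  replace (2 * PI * h 0%nat ^ 2 + _) with
    (plus (plus (scal (2 * PI - 0) (h 0%nat ^ 2)) (scal (2 * h 0%nat) 0))
       (RInt (fun t => Cmod (f t) ^ 2 * Cmod (g t) ^ 2) 0 (2 * PI)))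
    by (unfold plus, scal; simpl; unfold mult; simpl; unfold g; ring).
  apply is_RInt_ext with (2 := H3). intros t _.
  simpl rpoly. fold (g t). rewrite !Cmod2_alt.
  unfold plus, scal; simpl; unfold mult; simpl. unfold Re, Im. ring.
Qed.

(** By [RInt_rpoly_S] both sides have the same constant contribution. In the rest, [|f|^2 <= rho^2]
    on the left while the factor is exactly [rho^2] on the circle, which leaves [rho^2] times the
    induction hypothesis for the shifted sequence. *)
Lemma RInt_rpoly_le (f : R -> C) (rho : R) (n : nat) (h : nat -> R) :
  0 <= rho -> trigpoly f -> (forall t, Cmod (f t) <= rho) ->
  RInt (fun t => Cmod (rpoly h n (f t)) ^ 2) 0 (2 * PI)
  <= RInt (fun t => Cmod (rpoly h n (circle rho t)) ^ 2) 0 (2 * PI).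
Proof.
  intros Hr Hf Hle; revert h; induction n as [| n IH]; intros h; [apply Rle_refl |].
  assert (Hpi := PI_RGT_0).
  rewrite !RInt_rpoly_S by (apply trigpoly_circle || exact Hf).
  apply Rplus_le_compat_l.
  assert (Hc : Ccont f) by now apply Ccont_trigpoly.
  set (g := fun k => rpoly (fun k => h (S k)) n k).
  assert (Hg : forall w, Ccont w -> continuity (fun t => Cmod (g (w t)) ^ 2))
    by (intros w Hw; apply continuity_pow2, continuity_Cmod; now apply Ccont_rpoly).
  apply Rle_trans with (RInt (fun t => scal (rho ^ 2) (Cmod (g (f t)) ^ 2)) 0 (2 * PI)).
  - apply RInt_le; [lra | | |].
    + apply ex_RInt_continuity.
      apply (continuity_mult (fun t => Cmod (f t) ^ 2) (fun t => Cmod (g (f t)) ^ 2));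
        [| now apply Hg]. now apply continuity_pow2, continuity_Cmod.
    + apply (ex_RInt_scal (V := R_NormedModule)), ex_RInt_continuity; now apply Hg.
    + intros t _. unfold scal; simpl; unfold mult; simpl.
      apply Rmult_le_compat_r; [apply pow2_ge_0 |].
      apply (pow_incr _ _ 2); split; [apply Cmod_ge_0 | apply Hle].
  - rewrite (RInt_scal (V := R_CompleteNormedModule)) by (apply ex_RInt_continuity; now apply Hg).
    rewrite (RInt_ext (fun t => Cmod (circle rho t) ^ 2 * Cmod (g (circle rho t)) ^ 2)
      (fun t => scal (rho ^ 2) (Cmod (g (circle rho t)) ^ 2)))
      by (intros t _; now rewrite Cmod_circle).
    rewrite (RInt_scal (V := R_CompleteNormedModule))
      by (apply ex_RInt_continuity, Hg, Ccont_trigpoly, trigpoly_circle).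
    apply Rmult_le_compat_l; [apply pow2_ge_0 | apply IH].
Qed.

(** * Integral means and subordination *)

Lemma rpow_ge_0 (x g : R) : 0 <= rpow x g.
Proof.
  unfold rpow; destruct (Req_EM_T x 0); [lra | left; apply exp_pos].
Qed.

Lemma rpow_le (x y g : R) : 0 < g -> 0 <= x <= y -> rpow x g <= rpow y g.
Proof.
  intros Hg Hxy; unfold rpow.
  destruct (Req_EM_T x 0), (Req_EM_T y 0); try lra.
  - left; apply exp_pos.
  - apply Rle_Rpower_l; lra.
Qed.

Lemma rpow_mult (x y g : R) : 0 <= x -> 0 <= y -> rpow (x * y) g = rpow x g * rpow y g.
Proof.
  intros Hx Hy; unfold rpow.
  destruct (Req_EM_T x 0) as [-> | Hx0];
    [rewrite Rmult_0_l; destruct (Req_EM_T 0 0); [ring | contradiction] |].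
  destruct (Req_EM_T y 0) as [-> | Hy0];
    [rewrite Rmult_0_r; destruct (Req_EM_T 0 0); [ring | contradiction] |].
  destruct (Req_EM_T (x * y) 0) as [E | _].
  - apply Rmult_integral in E; tauto.
  - rewrite Rpower_mult_distr; lra.
Qed.

Lemma rpow_2 (x : R) : 0 <= x -> rpow x 2 = x ^ 2.
Proof.
  intros Hx; unfold rpow; destruct (Req_EM_T x 0) as [-> | Hx0]; [ring |].
  rewrite <- Rpower_pow by lra; reflexivity.
Qed.

Lemma rpow_rpow_2 (x g : R) : rpow (rpow x (g / 2)) 2 = rpow x g.
Proof.
  rewrite rpow_2 by apply rpow_ge_0.
  unfold rpow; destruct (Req_EM_T x 0); [ring |].
  rewrite <- Rpower_pow by apply exp_pos; rewrite Rpower_mult.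
  f_equal; simpl; field.
Qed.

(** The absolute value extends the power to the whole line, since [continuity] asks for two-sided
    neighbourhoods. At 0 the radius [eps^(1/g)] works; elsewhere the function is [exp (g ln |y|)]
    nearby. *)
Lemma continuity_rpow_abs (g : R) : 0 < g -> continuity (fun x => rpow (Rabs x) g).
Proof.
  intros Hg x. destruct (Req_dec x 0) as [-> | Hx].
  - intros eps Heps.
    exists (Rpower eps (/ g)); split; [apply exp_pos |].
    intros y [_ Hy]; simpl in *; unfold R_dist in *.
    rewrite Rabs_R0. rewrite Rminus_0_r in Hy.
    replace (rpow 0 g) with 0 by (unfold rpow; destruct (Req_EM_T 0 0); tauto).
    rewrite Rminus_0_r, Rabs_pos_eq by apply rpow_ge_0.
    unfold rpow; destruct (Req_EM_T (Rabs y) 0) as [E | E]; [exact Heps |].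
    assert (Hy0 : 0 < Rabs y) by (generalize (Rabs_pos y); lra).
    apply Rlt_le_trans with (Rpower (Rpower eps (/ g)) g).
    + apply Rlt_Rpower_l; lra.
    + rewrite Rpower_mult, Rinv_l, Rpower_1 by lra; lra.
  - apply continuity_pt_locally_ext with (f := fun y => exp (g * ln (Rabs y))) (a := Rabs x).
    + now apply Rabs_pos_lt.
    + intros y Hy. unfold rpow.
      destruct (Req_EM_T (Rabs y) 0) as [E | _]; [| reflexivity].
      exfalso. apply Rabs_eq_0 in E; subst y.
      unfold R_dist in Hy. rewrite Rminus_0_l, Rabs_Ropp in Hy. lra.
    + apply (continuity_pt_comp (fun y => g * ln (Rabs y)) exp);
        [| apply derivable_continuous_pt, derivable_pt_exp].
      apply (continuity_pt_mult (fun _ => g) (fun y => ln (Rabs y)));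
        [apply continuity_pt_const; intros u v; reflexivity |].
      apply (continuity_pt_comp Rabs ln); [apply Rcontinuity_abs |].
      apply derivable_continuous_pt. exists (/ Rabs x).
      apply derivable_pt_lim_ln, Rabs_pos_lt, Hx.
Qed.

Definition mean (g : R) (F : R -> R) : R := RInt (fun t => rpow (F t) g) 0 (2 * PI).

Definition nncont (F : R -> R) : Prop := continuity F /\ forall t, 0 <= F t.

Lemma nncont_Cmod (f : R -> C) : Ccont f -> nncont (fun t => Cmod (f t)).
Proof. intros Hf; split; [now apply continuity_Cmod | intros t; apply Cmod_ge_0]. Qed.

Lemma ex_mean (g : R) (F : R -> R) :
  0 < g -> nncont F -> ex_RInt (fun t => rpow (F t) g) 0 (2 * PI).
Proof.
  intros Hg [Hc Hp]. apply ex_RInt_ext with (fun t => rpow (Rabs (F t)) g).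
  - intros t _; now rewrite Rabs_pos_eq.
  - apply ex_RInt_continuity; intros t.
    apply (continuity_pt_comp F (fun x => rpow (Rabs x) g)); [apply Hc |].
    now apply continuity_rpow_abs.
Qed.

Lemma mean_ext (g : R) (F G : R -> R) : (forall t, F t = G t) -> mean g F = mean g G.
Proof. intros E; unfold mean; apply RInt_ext; intros t _; now rewrite E. Qed.

Lemma mean_le (g : R) (F G : R -> R) :
  0 < g -> nncont F -> nncont G -> (forall t, F t <= G t) -> mean g F <= mean g G.
Proof.
  intros Hg HF HG H; assert (Hpi := PI_RGT_0); unfold mean.
  apply RInt_le; [lra | now apply ex_mean | now apply ex_mean |].
  intros t _; apply rpow_le; [exact Hg | split; [apply HF | apply H]].
Qed.

Lemma mean_scal (g r : R) (F : R -> R) :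
  0 < g -> 0 <= r -> nncont F -> mean g (fun t => r * F t) = rpow r g * mean g F.
Proof.
  intros Hg Hr HF; unfold mean.
  rewrite (RInt_ext _ (fun t => scal (rpow r g) (rpow (F t) g))).
  - apply (RInt_scal (V := R_CompleteNormedModule)); now apply ex_mean.
  - intros t _; apply rpow_mult; [exact Hr | apply HF].
Qed.

(** Uniform continuity of the power on [[0, M]]. This covers [g < 1] as well, where the power is not
    Lipschitz at 0. *)
Lemma mean_close (g M eps : R) :
  0 < g -> 0 < eps -> exists del, 0 < del /\
  forall F G, nncont F -> nncont G -> (forall t, F t <= M) -> (forall t, G t <= M) ->
    (forall t, Rabs (F t - G t) < del) -> mean g F <= mean g G + eps.
Proof.
  intros Hg Heps. assert (Hpi := PI_RGT_0).
  assert (He : 0 < eps / (2 * PI)) by (apply Rdiv_lt_0_compat; lra).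
  destruct (Heine_cor2 (f := fun x => rpow (Rabs x) g) (a := 0) (b := M)
    (fun x _ => continuity_rpow_abs g Hg x) (mkposreal _ He)) as [del Hdel].
  exists del; split; [apply cond_pos |].
  intros F G HF HG HFM HGM Hclose.
  assert (HexG := ex_mean g G Hg HG).
  apply Rle_trans with (RInt (fun t => plus (rpow (G t) g) (eps / (2 * PI))) 0 (2 * PI)).
  - apply RInt_le; [lra | now apply ex_mean | |].
    + apply (ex_RInt_plus (V := R_NormedModule)); [exact HexG | apply ex_RInt_const].
    + intros t _. specialize (Hdel (F t) (G t)).
      destruct HF as [_ HF], HG as [_ HG].
      rewrite (Rabs_pos_eq (F t)), (Rabs_pos_eq (G t)) in Hdel by auto.
      assert (H := Hdel (conj (HF t) (HFM t)) (conj (HG t) (HGM t)) (Hclose t)).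
      simpl in H. apply Rabs_def2 in H. unfold plus; simpl; lra.
  - rewrite (RInt_plus (V := R_CompleteNormedModule)) by (exact HexG || apply ex_RInt_const).
    rewrite RInt_const. unfold plus, scal; simpl; unfold mult; simpl.
    apply Rplus_le_compat_l. right; field; lra.
Qed.

(** The device behind every passage to a uniform limit below: truncating the binomial series,
    letting the parameter tend to 1, and truncating [phi]. *)
Lemma mean_le_limit (g M : R) (F G : R -> R) :
  0 < g -> nncont F -> nncont G -> (forall t, F t <= M) -> (forall t, G t <= M) ->
  (forall e, 0 < e -> exists F1 G1, nncont F1 /\ nncont G1 /\
     (forall t, Rabs (F t - F1 t) <= e) /\ (forall t, Rabs (G1 t - G t) <= e) /\
     mean g F1 <= mean g G1) ->
  mean g F <= mean g G.
Proof.
  intros Hg HF HG HFM HGM H. apply Rnot_lt_le; intros Hlt.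
  (* Approximants within [e <= 1] are bounded by [M + 1]; losing a third of the supposed gap on
     either side still contradicts it. *)
  destruct (mean_close g (M + 1) ((mean g F - mean g G) / 3) Hg) as [d [Hd Hc]]; [lra |].
  set (e := Rmin (d / 2) 1).
  assert (He : 0 < e) by (apply Rmin_pos; lra).
  assert (He1 : e <= d / 2) by apply Rmin_l.
  assert (He2 : e <= 1) by apply Rmin_r.
  destruct (H e He) as [F1 [G1 [HF1 [HG1 [HdF [HdG Hle]]]]]].
  assert (mean g F <= mean g F1 + (mean g F - mean g G) / 3).
  { apply Hc; auto; intros t; specialize (HdF t); specialize (HFM t);
      try apply Rabs_le_between in HdF; try lra.
    apply Rabs_def1; lra. }
  assert (mean g G1 <= mean g G + (mean g F - mean g G) / 3).
  { apply Hc; auto; intros t; specialize (HdG t); specialize (HGM t);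
      try apply Rabs_le_between in HdG; try lra.
    apply Rabs_def1; lra. }
  lra.
Qed.

Lemma Cmod_minus_le (x y : C) : Rabs (Cmod x - Cmod y) <= Cmod (x - y)%C.
Proof.
  apply Rabs_le; split.
  - assert (H := Cmod_triangle (y - x)%C x).
    replace (y - x + x)%C with y in H by ring.
    replace (y - x)%C with (- (x - y))%C in H by ring.
    rewrite Cmod_opp in H; lra.
  - assert (H := Cmod_triangle (x - y)%C y).
    replace (x - y + y)%C with x in H by ring. lra.
Qed.

Lemma binomial_modulus_rpow (s : R) (x : C) :
  0 < s -> Cmod x < 1 -> Cmod (rps (binom_coef s) x) = rpow (Cmod (1 - x)%C) s.
Proof.
  intros Hs Hx.
  assert (Hpos : 0 < Cmod (1 - x)%C).
  { assert (H := Cmod_triangle (1 - x)%C x).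
    replace (1 - x + x)%C with (RtoC 1) in H by ring. rewrite Cmod_1 in H; lra. }
  assert (E := binomial_modulus s x Hs Hx).
  unfold rpow; destruct (Req_EM_T (Cmod (1 - x)%C) 0) as [E0 | _]; [lra |].
  rewrite <- (sqrt_pow2 (Cmod (rps _ _))) by apply Cmod_ge_0.
  rewrite E, <- (sqrt_pow2 (Rpower (Cmod (1 - x)%C) s)) by (left; apply exp_pos).
  f_equal. rewrite <- !(Rpower_pow 2) by (exact Hpos || apply exp_pos).
  rewrite !Rpower_mult; f_equal; ring.
Qed.

(** [(1 - z)^(g/2)] is analytic in the disc, so its truncations reduce the
    claim to [RInt_rpoly_le]. *)
Lemma littlewood_inside (g b : R) (f : R -> C) :
  0 < g -> 0 <= b < 1 -> trigpoly f -> (forall t, Cmod (f t) <= b) ->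
  mean g (fun t => Cmod (1 - f t)%C) <= mean g (fun t => Cmod (1 - circle b t)%C).
Proof.
  intros Hg Hb Hf Hle.
  destruct (binom_coef_bounded (g / 2)) as [M HM]; [lra |].
  set (h := binom_coef (g / 2)) in *.
  assert (Hg2 : 0 < g / 2) by lra.
  assert (HM0 : 0 <= M) by (apply Rle_trans with (2 := HM 0%nat), Rabs_pos).
  (* The [g]-mean is the quadratic mean of the power [g / 2], and [Hmod] below identifies that power
     with the modulus of the binomial series. *)
  assert (Hmean : forall w : R -> C,
    mean g (fun t => Cmod (1 - w t)%C) = mean 2 (fun t => rpow (Cmod (1 - w t)%C) (g / 2)))
    by (intros w; unfold mean; apply RInt_ext; intros t _; now rewrite rpow_rpow_2).
  assert (Hcont : forall w, Ccont w -> nncont (fun t => rpow (Cmod (1 - w t)%C) (g / 2))).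
  { intros w Hw; split; [| intros t; apply rpow_ge_0].
    assert (Hc : continuity (fun t => Cmod (1 - w t)%C))
      by (apply continuity_Cmod, Ccont_minus; [apply Ccont_const | exact Hw]).
    intros t. apply continuity_pt_ext with (fun t => rpow (Rabs (Cmod (1 - w t)%C)) (g / 2));
      [intros u; now rewrite Rabs_pos_eq by apply Cmod_ge_0 |].
    apply (continuity_pt_comp (fun t => Cmod (1 - w t)%C) (fun x => rpow (Rabs x) (g / 2)));
      [apply Hc | now apply continuity_rpow_abs]. }
  assert (Hmod : forall x, Cmod x <= b -> rpow (Cmod (1 - x)%C) (g / 2) = Cmod (rps h x))
    by (intros x Hx; symmetry; apply binomial_modulus_rpow; lra).
  assert (Hbd : forall x, Cmod x <= b -> rpow (Cmod (1 - x)%C) (g / 2) <= 2 * (M / (1 - b)))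
    by (intros x Hx; rewrite Hmod by exact Hx; now apply rps_bound).
  assert (Hcl : forall t, Cmod (circle b t) <= b) by (intros t; rewrite Cmod_circle; lra).
  assert (Hfc := Ccont_trigpoly f Hf).
  assert (Hcc := Ccont_trigpoly _ (trigpoly_circle b)).
  rewrite !Hmean.
  apply mean_le_limit with (M := 2 * (M / (1 - b))); auto; [lra |].
  intros e He.
  assert (Hn : exists n, b ^ S n * (2 * (M / (1 - b))) <= e).
  { set (K := 2 * (M / (1 - b)) + 1).
    assert (HK : 0 < K).
    { unfold K. assert (0 <= M / (1 - b)) by (apply Rdiv_le_0_compat; lra). lra. }
    destruct (pow_lt_1_zero b) with (y := e / K) as [n Hn].
    - rewrite Rabs_pos_eq; lra.
    - now apply Rdiv_lt_0_compat.
    - exists n. assert (H := Hn (S n) (Nat.le_succ_diag_r n)).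
      assert (Hbn : 0 <= b ^ S n) by (apply pow_le; lra).
      rewrite Rabs_pos_eq in H by exact Hbn.
      apply Rlt_div_r in H; [| exact HK]. unfold K in H; nra. }
  destruct Hn as [n Hn].
  exists (fun t => Cmod (rpoly h n (f t))), (fun t => Cmod (rpoly h n (circle b t))).
  assert (Happ : forall x, Cmod x <= b ->
    Rabs (rpow (Cmod (1 - x)%C) (g / 2) - Cmod (rpoly h n x)) <= e).
  { intros x Hx. rewrite Hmod by exact Hx.
    apply Rle_trans with (1 := Cmod_minus_le _ _).
    apply Rle_trans with (2 := Hn). now apply rps_rpoly. }
  split; [apply nncont_Cmod; now apply Ccont_rpoly |].
  split; [apply nncont_Cmod; now apply Ccont_rpoly |].
  split; [auto |].
  split; [intros t; rewrite Rabs_minus_sym; auto |].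
  unfold mean.
  rewrite (RInt_ext (fun t => rpow (Cmod (rpoly h n (f t))) 2)
    (fun t => Cmod (rpoly h n (f t)) ^ 2)) by (intros t _; apply rpow_2, Cmod_ge_0).
  rewrite (RInt_ext (fun t => rpow (Cmod (rpoly h n (circle b t))) 2)
    (fun t => Cmod (rpoly h n (circle b t)) ^ 2)) by (intros t _; apply rpow_2, Cmod_ge_0).
  apply RInt_rpoly_le; auto; lra.
Qed.

Lemma circle_scal (b t : R) : circle b t = (RtoC b * circle 1 t)%C.
Proof. apply injective_projections; simpl; ring. Qed.

Lemma Cmod_scal (b : R) (x : C) : 0 <= b -> Cmod (RtoC b * x)%C = b * Cmod x.
Proof. intros Hb; rewrite Cmod_mult, Cmod_R, Rabs_pos_eq by exact Hb; reflexivity. Qed.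

Lemma Ccont_one_minus_scal (b : R) (f : R -> C) :
  Ccont f -> Ccont (fun t => 1 - RtoC b * f t)%C.
Proof.
  intros Hf; apply Ccont_minus; [apply Ccont_const |].
  apply Ccont_mult; [apply Ccont_const | exact Hf].
Qed.

Lemma Cmod_one_minus_scal_le (b : R) (x : C) :
  0 <= b -> Cmod x <= 1 -> Cmod (1 - RtoC b * x)%C <= 1 + b.
Proof.
  intros Hb Hx. unfold Cminus. apply Rle_trans with (1 := Cmod_triangle _ _).
  rewrite Cmod_opp, Cmod_1, Cmod_scal by exact Hb. nra.
Qed.

Lemma littlewood_closed (g b : R) (f : R -> C) :
  0 < g -> 0 <= b <= 1 -> trigpoly f -> (forall t, Cmod (f t) <= 1) ->
  mean g (fun t => Cmod (1 - RtoC b * f t)%C)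
  <= mean g (fun t => Cmod (1 - RtoC b * circle 1 t)%C).
Proof.
  intros Hg Hb Hf Hle.
  assert (Hcl : forall t, Cmod (circle 1 t) <= 1) by (intros t; rewrite Cmod_circle; lra).
  assert (Hfc := Ccont_trigpoly f Hf).
  assert (Hcc := Ccont_trigpoly _ (trigpoly_circle 1)).
  apply mean_le_limit with (M := 1 + b); [exact Hg | | | | |].
  1, 2: now apply nncont_Cmod, Ccont_one_minus_scal.
  1, 2: intros t; apply Cmod_one_minus_scal_le; auto; lra.
  intros e He.
  set (d := Rmin e 1).
  assert (Hd : 0 < d) by (apply Rmin_pos; lra).
  assert (Hd1 : d <= 1) by apply Rmin_r.
  assert (Hde : d <= e) by apply Rmin_l.
  (* Less than 1 even for [b = 1], and it changes the modulus by at most [b * d <= e]. *)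
  set (b1 := b * (1 - d)).
  assert (Hb1 : 0 <= b1 < 1) by (unfold b1; split; nra).
  exists (fun t => Cmod (1 - RtoC b1 * f t)%C), (fun t => Cmod (1 - RtoC b1 * circle 1 t)%C).
  assert (Hdiff : forall x, Cmod x <= 1 ->
    Rabs (Cmod (1 - RtoC b * x)%C - Cmod (1 - RtoC b1 * x)%C) <= e).
  { intros x Hx. apply Rle_trans with (1 := Cmod_minus_le _ _).
    replace (1 - RtoC b * x - (1 - RtoC b1 * x))%C with (- (RtoC (b * d) * x))%C
      by (unfold b1; rewrite !RtoC_mult, RtoC_minus; ring).
    rewrite Cmod_opp, Cmod_scal by nra. generalize (Cmod_ge_0 x); intros H0.
    assert (b * d <= d) by nra. assert (0 <= b * d) by nra. nra. }
  split; [now apply nncont_Cmod, Ccont_one_minus_scal |].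
  split; [now apply nncont_Cmod, Ccont_one_minus_scal |].
  split; [auto |].
  split; [intros t; rewrite Rabs_minus_sym; auto |].
  rewrite (mean_ext g (fun t => Cmod (1 - RtoC b1 * circle 1 t)%C)
    (fun t => Cmod (1 - circle b1 t)%C)) by (intros t; now rewrite (circle_scal b1)).
  apply littlewood_inside; auto.
  - now apply trigpoly_scal.
  - intros t; rewrite Cmod_scal by lra. specialize (Hle t); nra.
Qed.

(** The Blaschke factor [(b z - 1) / (b - z)] has modulus at most [1] on the
    disc and [1] on the circle, so the zero [1 / b] can be moved outside. *)
Lemma blaschke_swap (b : R) (x : C) :
  1 <= b -> Cmod x <= 1 -> Cmod (1 - RtoC b * x)%C <= Cmod (RtoC b - x)%C.
Proof.
  intros Hb Hx.
  assert (Hx2 : Cmod x ^ 2 <= 1 ^ 2) by (apply pow_incr; split; [apply Cmod_ge_0 | exact Hx]).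
  rewrite Cmod2_alt in Hx2.
  unfold Cmod; apply sqrt_le_1_alt.
  destruct x as [u v]; unfold Re, Im in Hx2; simpl in *.
  (* This product is [|b - x|^2 - |1 - b x|^2]. *)
  assert (0 <= (b * b - 1) * (1 - u * u - v * v)) by (apply Rmult_le_pos; nra).
  nra.
Qed.

Lemma blaschke_swap_circle (b t : R) :
  Cmod (1 - RtoC b * circle 1 t)%C = Cmod (RtoC b - circle 1 t)%C.
Proof.
  unfold Cmod; f_equal. unfold circle; simpl.
  generalize (sin2_cos2 t); unfold Rsqr; intros E.
  transitivity (1 - 2 * b * cos t + b ^ 2 * (sin t * sin t + cos t * cos t)); [ring |].
  transitivity (b ^ 2 - 2 * b * cos t + (sin t * sin t + cos t * cos t)); [rewrite E |]; ring.
Qed.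

(** For [b > 1], [|1 - b f| <= |b - f| = b |1 - f / b|], and the closed case applies with parameter
    [1 / b]. On the circle the first step is an equality, so the same factor [b^g] appears on both
    sides. *)
Lemma littlewood (g b : R) (f : R -> C) :
  0 < g -> 0 <= b -> trigpoly f -> (forall t, Cmod (f t) <= 1) ->
  mean g (fun t => Cmod (1 - RtoC b * f t)%C)
  <= mean g (fun t => Cmod (1 - RtoC b * circle 1 t)%C).
Proof.
  intros Hg Hb Hf Hle.
  destruct (Rle_dec b 1) as [Hb1 | Hb1]; [now apply littlewood_closed |].
  assert (Hfc := Ccont_trigpoly f Hf).
  assert (Hcc := Ccont_trigpoly _ (trigpoly_circle 1)).
  assert (Hswap : forall x, Cmod (RtoC b - x)%C = b * Cmod (1 - RtoC (/ b) * x)%C).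
  { intros x. rewrite <- Cmod_scal by lra. f_equal.
    rewrite RtoC_inv by lra. field. intros E; apply RtoC_inj in E; lra. }
  apply Rle_trans with (mean g (fun t => b * Cmod (1 - RtoC (/ b) * f t)%C)).
  - apply mean_le; [exact Hg | now apply nncont_Cmod, Ccont_one_minus_scal | |].
    + destruct (nncont_Cmod _ (Ccont_one_minus_scal (/ b) f Hfc)) as [H1 H2].
      split; [| intros t; apply Rmult_le_pos; [exact Hb | apply H2]].
      now apply (continuity_scal _ b).
    + intros t; rewrite <- Hswap. apply blaschke_swap; [lra | apply Hle].
  - rewrite (mean_ext g (fun t => Cmod (1 - RtoC b * circle 1 t)%C)
      (fun t => b * Cmod (1 - RtoC (/ b) * circle 1 t)%C))
      by (intros t; rewrite <- Hswap; apply blaschke_swap_circle).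
    rewrite !mean_scal by (auto; now apply nncont_Cmod, Ccont_one_minus_scal).
    apply Rmult_le_compat_l; [apply rpow_ge_0 |].
    apply littlewood_closed; auto.
    split; [left; apply Rinv_0_lt_compat; lra |].
    rewrite <- Rinv_1; apply Rinv_le_contravar; lra.
Qed.

(** * Truncations of the power series and the conclusion *)

Lemma continuity_uniform_limit (F : R -> R) :
  (forall e, 0 < e -> exists F1, continuity F1 /\ forall t, Rabs (F t - F1 t) <= e) ->
  continuity F.
Proof.
  intros H t eps Heps.
  destruct (H (eps / 4)) as [F1 [Hc Hcl]]; [lra |].
  destruct (Hc t (eps / 4)) as [d [Hd Hd1]]; [lra |].
  exists d; split; [exact Hd |]; intros y Hy.
  specialize (Hd1 y Hy). simpl in *; unfold R_dist in *.
  assert (H1 := Hcl t). assert (H2 := Hcl y).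
  apply Rabs_le_between in H1. apply Rabs_le_between in H2.
  apply Rabs_def2 in Hd1. apply Rabs_def1; lra.
Qed.

(** A partial sum of [(z - phi z) / z], the function called [a w] in the overview; with one factor
    [z] divided out, [c (n + 3)] goes with [z^(n + 2)]. *)
Fixpoint cpoly (c : nat -> R) (N : nat) (z : C) : C :=
  match N with
  | O => (c 2%nat * z)%C
  | S n => (cpoly c n z + c (n + 3)%nat * z ^ (n + 2))%C
  end.

Lemma cpoly_sum_n (c : nat -> R) (N : nat) (z : C) :
  sum_n (G := C_AbelianMonoid) (fun k => c (k + 2)%nat * z ^ (k + 2))%C N
  = (z * cpoly c N z)%C.
Proof.
  induction N as [| N IH]; [rewrite sum_O; simpl; ring |].
  rewrite sum_Sn, IH.
  replace (S N + 2)%nat with (N + 3)%nat by lia.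
  change ((z * cpoly c N z + c (N + 3)%nat * z ^ (N + 3))%C = (z * cpoly c (S N) z)%C).
  replace (N + 3)%nat with (S (N + 2)) at 2 by lia.
  simpl; ring.
Qed.

Lemma trigpoly_cpoly (c : nat -> R) (N : nat) (f : R -> C) :
  trigpoly f -> trigpoly (fun t => cpoly c N (f t)).
Proof.
  intros Hf.
  assert (Hpow : forall n, trigpoly (fun t => f t ^ S n)%C).
  { intros n; induction n as [| n IH].
    - apply trigpoly_ext with (2 := Hf); intros t; simpl; ring.
    - exact (trigpoly_mult _ _ Hf IH). }
  induction N as [| N IH]; simpl.
  - now apply trigpoly_scal.
  - apply trigpoly_plus; [exact IH |].
    replace (N + 2)%nat with (S (S N)) by lia. apply trigpoly_scal, Hpow.
Qed.

Lemma sum_n_S (u : nat -> R) (n : nat) : sum_n u (S n) = sum_n u n + u (S n).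
Proof. exact (sum_Sn u n). Qed.

(** Every power of [z] here has exponent at least 1, so a factor [r] comes out. This gain plays the
    role of Schwarz's lemma and is why the parameter is [b = a * r]. *)
Lemma Cmod_cpoly (c : nat -> R) (N : nat) (r : R) (z : C) :
  (forall n, (2 <= n)%nat -> 0 <= c n) -> r <= 1 -> Cmod z <= r ->
  Cmod (cpoly c N z) <= r * sum_n (fun k => c (k + 2)%nat) N.
Proof.
  intros Hc Hr Hz.
  assert (H0 := Cmod_ge_0 z).
  induction N as [| N IH].
  - rewrite sum_O; simpl. rewrite Cmod_scal by (apply Hc; lia).
    rewrite Rmult_comm. apply Rmult_le_compat_r; [apply Hc; lia | exact Hz].
  - rewrite sum_n_S. simpl cpoly. apply Rle_trans with (1 := Cmod_triangle _ _).
    rewrite Rmult_plus_distr_l.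
    apply Rplus_le_compat; [exact IH |].
    replace (S N + 2)%nat with (N + 3)%nat by lia.
    assert (Hc0 : 0 <= c (N + 3)%nat) by (apply Hc; lia).
    rewrite Cmod_scal by exact Hc0. rewrite (Rmult_comm r).
    apply Rmult_le_compat_l; [exact Hc0 |].
    rewrite Cmod_pow. replace (N + 2)%nat with (S (S N)) by lia.
    rewrite <- (Rmult_1_r r), <- tech_pow_Rmult.
    apply Rmult_le_compat; [exact H0 | now apply pow_le | lra |].
    rewrite <- (pow1 (S N)); apply pow_incr; lra.
Qed.

(** All powers beyond the truncation are at most [r^N], and the coefficients in front of them sum to
    at most [a]. The bound depends on [z] only through [r], hence is uniform on the circle. *)
Lemma cpoly_tail (c : nat -> R) (a r : R) (N : nat) (z l : C) :
  (forall n, (2 <= n)%nat -> 0 <= c n) ->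
  (forall N, sum_n (fun k => c (k + 2)%nat) N <= a) ->
  r <= 1 -> Cmod z <= r ->
  is_series (K := C_AbsRing) (V := C_NormedModule)
    (fun k => c (k + 2)%nat * z ^ (k + 2))%C l ->
  Cmod (l - z * cpoly c N z)%C <= r ^ N * a.
Proof.
  intros Hc Ha Hr Hz Hs.
  assert (H0 := Cmod_ge_0 z).
  assert (Hsum : forall N, 0 <= sum_n (fun k => c (k + 2)%nat) N).
  { intros m; rewrite sum_n_Reals; apply cond_pos_sum; intros k; apply Hc; lia. }
  assert (Hdiff : forall m,
    Cmod (z * cpoly c (N + m) z - z * cpoly c N z)%C
    <= r ^ N * (sum_n (fun k => c (k + 2)%nat) (N + m) - sum_n (fun k => c (k + 2)%nat) N)).
  { induction m as [| m IH].
    - rewrite Nat.add_0_r.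
      replace (_ - _)%C with (RtoC 0) by ring. rewrite Cmod_0; lra.
    - rewrite Nat.add_succ_r, sum_n_S.
      replace (S (N + m) + 2)%nat with (N + m + 3)%nat by lia.
      assert (Hc0 : 0 <= c (N + m + 3)%nat) by (apply Hc; lia).
      simpl cpoly.
      replace (z * (cpoly c (N + m) z + c (N + m + 3)%nat * z ^ (N + m + 2))
               - z * cpoly c N z)%C
        with ((z * cpoly c (N + m) z - z * cpoly c N z)
              + c (N + m + 3)%nat * z ^ (N + (m + 3)))%C
        by (replace (N + (m + 3))%nat with (S (N + m + 2)) by lia; simpl; ring).
      apply Rle_trans with (1 := Cmod_triangle _ _).
      rewrite Cmod_scal, Cmod_pow by exact Hc0.
      assert (Cmod z ^ (N + (m + 3)) <= r ^ N).
      { rewrite pow_add, <- (Rmult_1_r (r ^ N)).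
        apply Rmult_le_compat; try (now apply pow_le).
        - now apply pow_incr.
        - rewrite <- (pow1 (m + 3)); apply pow_incr; lra. }
      assert (c (N + m + 3)%nat * Cmod z ^ (N + (m + 3)) <= c (N + m + 3)%nat * r ^ N)
        by (now apply Rmult_le_compat_l).
      lra. }
  apply le_epsilon; intros eps Heps.
  unfold is_series in Hs.
  apply (proj1 (filterlim_locally_ball_norm (K := C_AbsRing) (U := C_NormedModule) _ _))
    with (eps := mkposreal _ Heps) in Hs.
  destruct Hs as [m0 Hm0].
  specialize (Hm0 (N + m0)%nat ltac:(lia)).
  unfold ball_norm in Hm0. rewrite cpoly_sum_n in Hm0.
  change (Cmod (z * cpoly c (N + m0) z - l)%C < eps) in Hm0.
  specialize (Hdiff m0).
  replace (l - z * cpoly c N z)%C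
    with (- (z * cpoly c (N + m0) z - l) + (z * cpoly c (N + m0) z - z * cpoly c N z))%C by ring.
  apply Rle_trans with (1 := Cmod_triangle _ _). rewrite Cmod_opp.
  assert (r ^ N * (sum_n (fun k => c (k + 2)%nat) (N + m0)
    - sum_n (fun k => c (k + 2)%nat) N) <= r ^ N * a).
  { apply Rmult_le_compat_l; [apply pow_le; lra |].
    generalize (Ha (N + m0)%nat) (Hsum N); lra. }
  lra.
Qed.

(** Since [pqnum p q 2 = p + q], the factor [1 + (p + q - 1) * tau] fails to be positive when
    [p + q < 1] and [tau] is large. [hpos] rules this out, so that dividing by the second weight
    keeps the direction of the coefficient inequality. *)
Theorem theorem7p2 (p q tau eta : R) (kappa xi : nat)
  (hp : 0 < p) (hpq : p < q) (hq : q <= 1)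
  (htau : 0 <= tau) (heta0 : 0 <= eta) (heta1 : eta < 1)
  (hmono : forall n : nat, (2 <= n)%nat ->
     weight p q xi kappa tau eta n <= weight p q xi kappa tau eta (S n))
  (hpos : 0 < weight p q xi kappa tau eta 2)
  (phi : C -> C) (hphi : classP p q xi kappa tau eta phi)
  (r gamma : R) (hr0 : 0 < r) (hr1 : r < 1) (hgamma : 0 < gamma) :
  RInt (fun theta => rpow (Cmod (phi (circle r theta))) gamma) 0 (2 * PI)
  <= RInt (fun theta =>
       rpow (Cmod (phi_star p q xi kappa tau eta (circle r theta))) gamma)
       0 (2 * PI).
Proof.
  destruct hphi as [HQ [_ [c [Hc Hser]]]].
  destruct (T_coef_series phi c Hser) as [Hrad Hreal].
  set (a := (1 - eta) / weight p q xi kappa tau eta 2).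
  assert (Ha : 0 < a) by (apply Rdiv_lt_0_compat; lra).
  assert (Hsum : forall N, sum_n (fun k => c (k + 2)%nat) N <= a)
    by (intros N; now apply classP_coef_sum with (f := phi)).
  set (b := a * r). assert (Hb : 0 < b) by (now apply Rmult_lt_0_compat).
  assert (Hz : forall t, Cmod (circle r t) = r) by (intros t; apply Cmod_circle; lra).
  assert (Hstar : forall t, Cmod (phi_star p q xi kappa tau eta (circle r t))
                            = r * Cmod (1 - RtoC b * circle 1 t)%C).
  { intros t. rewrite <- (Hz t) at 2. rewrite <- Cmod_mult. f_equal. unfold phi_star.
    replace ((1 - eta) / _) with a.
    - unfold b. rewrite RtoC_mult, (circle_scal r). simpl; ring.
    - unfold a, weight. simpl INR. f_equal. f_equal. f_equal. ring. }
  (* Truncations of [w] on the circle of radius [r], divided by their bound [b] so that they have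
     modulus at most 1; [|phi|] is then close to [r |1 - b f|]. *)
  set (f := fun N t => (RtoC (/ b) * cpoly c N (circle r t))%C).
  assert (Hf : forall N, trigpoly (f N))
    by (intros N; apply trigpoly_scal, trigpoly_cpoly, trigpoly_circle).
  assert (Hf1 : forall N t, Cmod (f N t) <= 1).
  { intros N t. unfold f. rewrite Cmod_scal by (left; now apply Rinv_0_lt_compat).
    apply Rmult_le_reg_l with (1 := Hb). rewrite <- Rmult_assoc, Rinv_r, Rmult_1_l by lra.
    rewrite Rmult_1_r.
    apply Rle_trans with (1 := Cmod_cpoly c N r (circle r t) Hc ltac:(lra) ltac:(rewrite Hz; lra)).
    unfold b; rewrite Rmult_comm. apply Rmult_le_compat_r; [lra | apply Hsum]. }
  assert (Hnn : forall w, Ccont w -> nncont (fun t => r * Cmod (1 - RtoC b * w t)%C)).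
  { intros w Hw. destruct (nncont_Cmod _ (Ccont_one_minus_scal b w Hw)) as [H1 H2].
    split; [now apply (continuity_scal _ r) |].
    intros t; apply Rmult_le_pos; [lra | apply H2]. }
  assert (Hbd : forall x, Cmod x <= 1 -> r * Cmod (1 - RtoC b * x)%C <= 1 + b).
  { intros x Hx. assert (H1 := Cmod_one_minus_scal_le b x ltac:(lra) Hx).
    generalize (Cmod_ge_0 (1 - RtoC b * x)%C); nra. }
  assert (Happ : forall e, 0 < e -> exists N, forall t,
    Rabs (Cmod (phi (circle r t)) - r * Cmod (1 - RtoC b * f N t)%C) <= e).
  { intros e He.
    destruct (pow_lt_1_zero r) with (y := e / a) as [N HN];
      [rewrite Rabs_pos_eq; lra | now apply Rdiv_lt_0_compat |].
    exists N; intros t.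
    specialize (HN N (Nat.le_refl N)).
    rewrite Rabs_pos_eq in HN by (apply pow_le; lra).
    apply Rlt_div_r in HN; [| exact Ha].
    rewrite <- (Hz t) at 2. rewrite <- Cmod_mult.
    apply Rle_trans with (1 := Cmod_minus_le _ _).
    assert (HO : Omega (circle r t)) by (unfold Omega; now rewrite Hz).
    assert (Ht := cpoly_tail c a r N (circle r t) _ Hc Hsum ltac:(lra) ltac:(rewrite Hz; lra)
      (Hser _ HO)).
    apply Rle_trans with (2 := Rlt_le _ _ HN). apply Rle_trans with (2 := Ht).
    rewrite <- Cmod_opp. right; f_equal. unfold f. rewrite RtoC_inv by lra.
    field. intros E; apply RtoC_inj in E; lra. }
  change (mean gamma (fun t => Cmod (phi (circle r t)))
    <= mean gamma (fun t => Cmod (phi_star p q xi kappa tau eta (circle r t)))).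
  rewrite (mean_ext gamma _ _ Hstar).
  assert (Hcirc := Ccont_trigpoly _ (trigpoly_circle 1)).
  assert (Hc1 : forall t, Cmod (circle 1 t) <= 1) by (intros t; rewrite Cmod_circle; lra).
  (* The approximants are at most [1 + b], and [phi] is within 1 of one of them. *)
  apply mean_le_limit with (M := 2 + b); [exact hgamma | | now apply Hnn | | |].
  - split; [| intros t; apply Cmod_ge_0].
    (* Continuity of [|phi|] on the circle is inherited from the truncations. *)
    apply continuity_uniform_limit; intros e He.
    destruct (Happ e He) as [N HN].
    eexists; split; [| exact HN]. apply Hnn, Ccont_trigpoly, Hf.
  - intros t. destruct (Happ 1 Rlt_0_1) as [N HN]. specialize (HN t).
    apply Rabs_le_between in HN. generalize (Hbd _ (Hf1 N t)); lra.
  - intros t; generalize (Hbd _ (Hc1 t)); lra.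
  - intros e He. destruct (Happ e He) as [N HN].
    (* Only [phi] is approximated; the side of [phi_star] is already exact. *)
    exists (fun t => r * Cmod (1 - RtoC b * f N t)%C),
      (fun t => r * Cmod (1 - RtoC b * circle 1 t)%C).
    split; [apply Hnn, Ccont_trigpoly, Hf |].
    split; [now apply Hnn |]. split; [exact HN |].
    split; [intros t; rewrite Rminus_diag, Rabs_R0; lra |].
    rewrite !mean_scal
      by (try apply nncont_Cmod, Ccont_one_minus_scal; auto using Ccont_trigpoly; lra).
    apply Rmult_le_compat_l; [apply rpow_ge_0 |].
    apply littlewood; auto; lra.
Qed.
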